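(* (i) Assume that $u\in C^{1,1}_{loc}(\mathbb{R}^n)\cap L^\infty(\mathbb{R}^n)$. For $\alpha\in(0,2)$ let $$\mathcal{L}_{\mathcal{K}}u(x)=\frac{4n}{\omega_n}\,\mathrm{P.V.}\int_{\mathbb{R}^n}(u(x)-u(x+y))\mathcal{K}(y)\,dy,\qquad \mathcal{K}(y)=\frac{1}{\Gamma\left(\frac{2-\alpha}{2}\right)}\frac{e^{-|y|^2}}{|y|^{n+\alpha}}.$$ Then, for each fixed $x$, $$\lim_{\alpha\to2^-}\mathcal{L}_{\mathcal{K}}u(x)=-\Delta u(x).$$ (ii) Assume that $u\in C^{1,1}_{loc}(\mathbb{R}^n)\cap L^\infty(\mathbb{R}^n)$. Let $1\le p<\infty$ and, for $\alpha\in(0,2)$, let $$\mathcal{L}_{\mathbb{K}}u(x)=C_n\,\mathrm{P.V.}\int_{\mathbb{R}^n}(u(x)-u(x+y))\mathbb{K}(y)\,dy,\qquad \mathbb{K}(y)=(2-\alpha)\frac{1}{\|y\|^{n+\alpha}},\qquad \|y\|=\left(\sum_{i=1}^n|y_i|^p\right)^{1/p}.$$ Then, for each fixed $x$, $$\lim_{\alpha\to2^-}\mathcal{L}_{\mathbb{K}}u(x)=-C_{n,p}\,\Delta u(x),$$ where $C_{n,p}$ is a positive constant depending on $n$ and $p$.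
   Context: $\mathrm{P.V.}$ denotes the Cauchy principal value, $\Gamma$ is the Gamma function, $\omega_n$ is the surface area of the unit sphere in $\mathbb{R}^n$, $|\cdot|$ is the Euclidean norm, and $C_n>0$ is a constant depending only on $n$ (not on $\alpha$).
   Formalization: ''For each fixed x'' is restricted to points x where the gradient of u is differentiable (almost every x): for C^{1,1}_loc functions Δu(x) may not exist elsewhere, and the claim fails e.g. for u=|y|² cos 4θ (cut off) at 0 in R², where the limit is 0 but −Δu(0)=−4. *)

(* Defs.v *)
From HB Require Import structures.
From mathcomp Require Import all_boot all_order all_algebra.
From mathcomp Require Import all_classical all_reals all_analysis.

Set Implicit Arguments.
Unset Strict Implicit.
Unset Printing Implicit Defensive.

Import Order.TTheory GRing.Theory Num.Theory.
Import numFieldNormedType.Exports.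

Local Open Scope classical_set_scope.
Local Open Scope ring_scope.

Definition row_display : measure_display -> measure_display.
Proof. exact. Qed.

Section measurable_row.
Context {d} {T : measurableType d}.
Variable n : nat.

Let coords : 'I_n -> 'rV[T]_n -> T := fun i v => v ord0 i.

Let row_set0 : g_sigma_preimage coords set0.
Proof. exact: sigma_algebra0. Qed.

Let row_setC A : g_sigma_preimage coords A -> g_sigma_preimage coords (~` A).
Proof. exact: sigma_algebraC. Qed.

Let row_bigcup (F : _^nat) : (forall i, g_sigma_preimage coords (F i)) ->
  g_sigma_preimage coords (\bigcup_i (F i)).
Proof. exact: sigma_algebra_bigcup. Qed.

HB.instance Definition _ := @isMeasurable.Build (row_display d)
  'rV[T]_n (g_sigma_preimage coords) row_set0 row_setC row_bigcup.

Lemma measurable_row_coord (i : 'I_n) :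
  measurable_fun [set: 'rV[T]_n] (fun v : 'rV[T]_n => v ord0 i).
Proof.
move=> _ Y mY; rewrite setTI; apply: sub_sigma_algebra => /=.
rewrite -bigcup_seq/=; exists i => /=; first by rewrite mem_index_enum.
by exists Y => //; rewrite setTI.
Qed.

End measurable_row.

Lemma measurable_fun_row d1 d2 (T1 : measurableType d1)
    (T2 : measurableType d2) n (f : T1 -> 'rV[T2]_n) :
  (forall i, measurable_fun [set: T1] (fun x => f x ord0 i)) ->
  measurable_fun [set: T1] f.
Proof.
move=> mf; pose c := fun (i : 'I_n) (v : 'rV[T2]_n) => v ord0 i.
suff mfc : g_sigma_preimage (fun i => c i \o f) `<=` measurable.
  move=> _ A mA; apply: mfc; rewrite (g_sigma_preimage_comp c f).
  by exists A.
apply: smallest_sub; first exact: sigma_algebra_measurable.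
rewrite -bigcup_seq => A [i _ [B mB <-]].
exact: mf.
Qed.

Section row_cons.
Variable R : realType.

Definition row_cons n (z : R * 'rV[R]_n) : 'rV[R]_n.+1 :=
  \row_i if unlift ord0 i is Some j then z.2 ord0 j else z.1.

Lemma row_cons0 n (z : R * 'rV[R]_n) : row_cons z ord0 ord0 = z.1.
Proof. by rewrite mxE unlift_none.
Qed.

Lemma row_consS n (z : R * 'rV[R]_n) (i : 'I_n) :
  row_cons z ord0 (lift ord0 i) = z.2 ord0 i.
Proof. by rewrite mxE liftK.
Qed.

Lemma row_cons_behead n (v : 'rV[R]_n.+1) :
  row_cons (v ord0 ord0, \row_i v ord0 (lift ord0 i)) = v.
Proof.
apply/rowP => i; case: (unliftP ord0 i) => [j|] ->.
  by rewrite row_consS mxE.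
by rewrite row_cons0.
Qed.

Lemma measurable_row_cons n :
  measurable_fun [set: R * 'rV[R]_n] (@row_cons n).
Proof.
apply: measurable_fun_row => i; case: (unliftP ord0 i) => [j|] ->.
  rewrite (_ : (fun _ => _) = (fun v : 'rV[R]_n => v ord0 j) \o snd); last first.
    by apply/funext => z; exact: row_consS.
  by apply: measurableT_comp => //; exact: measurable_row_coord.
rewrite (_ : (fun _ => _) = fst) //.
by apply/funext => z; exact: row_cons0.
Qed.

Lemma measurable_row_behead n :
  measurable_fun [set: 'rV[R]_n.+1]
    (fun v => (v ord0 ord0, \row_(i < n) v ord0 (lift ord0 i))).
Proof.
apply: measurable_fun_pair; first exact: measurable_row_coord.
apply: measurable_fun_row => i.
rewrite (_ : (fun _ => _) = fun v : 'rV[R]_n.+1 => v ord0 (lift ord0 i)).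
  exact: measurable_row_coord.
by apply/funext => v; rewrite mxE.
Qed.

End row_cons.

Section lebesgue_row.
Variable R : realType.
Local Open Scope ereal_scope.

Section step.
Variables (n : nat) (mu : {sigma_finite_measure set 'rV[R]_n -> \bar R}).

Definition lebesgue_cons : set 'rV[R]_n.+1 -> \bar R :=
  pushforward (@lebesgue_measure R \x mu) (@row_cons R n).

Let lebesgue_cons0 : lebesgue_cons set0 = 0.
Proof. by rewrite /lebesgue_cons /pushforward preimage_set0 measure0. Qed.

Let lebesgue_cons_ge0 A : 0 <= lebesgue_cons A.
Proof. by rewrite /lebesgue_cons /pushforward; exact: measure_ge0. Qed.

Let lebesgue_cons_sigma_additive : semi_sigma_additive lebesgue_cons.
Proof.
move=> F mF tF mUF; rewrite /lebesgue_cons /pushforward preimage_bigcup.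
apply: measure_semi_sigma_additive.
- by move=> k; rewrite -[X in measurable X]setTI; exact: measurable_row_cons.
- apply/trivIsetP => /= i j _ _ ij; rewrite -preimage_setI.
  by move/trivIsetP : tF => /(_ _ _ _ _ ij) ->//; rewrite preimage_set0.
- rewrite -preimage_bigcup -[X in measurable X]setTI.
  exact: measurable_row_cons.
Qed.

HB.instance Definition _ := isMeasure.Build _ _ _ lebesgue_cons
  lebesgue_cons0 lebesgue_cons_ge0 lebesgue_cons_sigma_additive.

Lemma lebesgue_consX (A : set R) (B : set 'rV[R]_n) :
    measurable A -> measurable B ->
  lebesgue_cons [set v : 'rV[R]_n.+1 | A (v ord0 ord0) /\
    B (\row_(i < n) v ord0 (lift ord0 i))] = lebesgue_measure A * mu B.
Proof.
move=> mA mB; rewrite -product_measure1E//; congr (product_measure1 _ _ _).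
have tlE t (v : 'rV[R]_n) : \row_i row_cons (t, v) ord0 (lift ord0 i) = v.
  by apply/rowP => i; rewrite mxE row_consS.
by apply/seteqP; split=> -[t v] /=; rewrite row_cons0 tlE.
Qed.

Let lebesgue_cons_sigma_finite : sigma_finite setT lebesgue_cons.
Proof.
have /sigma_finiteP[F [TF ndF Foo]] := sigma_finiteT (@lebesgue_measure R).
have /sigma_finiteP[G [TG ndG Goo]] := sigma_finiteT mu.
exists (fun k => [set v : 'rV[R]_n.+1 | F k (v ord0 ord0) /\
    G k (\row_(i < n) v ord0 (lift ord0 i))]).
  apply/seteqP; split => // v _.
  have [i _ Fi] : (\bigcup_k F k) (v ord0 ord0) by rewrite -TF.
  have [j _ Gj] : (\bigcup_k G k) (\row_(i < n) v ord0 (lift ord0 i)).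
    by rewrite -TG.
  exists (maxn i j) => //; split.
    by move: Fi; exact/subsetPset/ndF/leq_maxl.
  by move: Gj; exact/subsetPset/ndG/leq_maxr.
move=> k; have [mF Fk] := Foo k; have [mG Gk] := Goo k; split.
  rewrite -[X in measurable X]setTI.
  rewrite (_ : [set v | _] = (fun v : 'rV[R]_n.+1 =>
    (v ord0 ord0, \row_(i < n) v ord0 (lift ord0 i))) @^-1` (F k `*` G k))//.
  by apply: measurable_row_behead => //; exact: measurableX.
by rewrite lebesgue_consX// lte_mul_pinfty// ge0_fin_numE.
Qed.

HB.instance Definition _ := @isSFinite.Build _ _ _ lebesgue_cons
  (sfinite_measure_sigma_finite lebesgue_cons_sigma_finite).
HB.instance Definition _ := @isSigmaFinite.Build _ _ _ lebesgue_cons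
  lebesgue_cons_sigma_finite.

End step.

Fixpoint lebesgue_row n : {sigma_finite_measure set 'rV[R]_n -> \bar R} :=
  match n with
  | 0%N => [the {sigma_finite_measure set 'rV[R]_0 -> \bar R} of dirac (0 : 'rV[R]_0)%R]
  | n'.+1 => [the {sigma_finite_measure set 'rV[R]_n'.+1 -> \bar R}
               of lebesgue_cons (lebesgue_row n')]
  end.

Lemma lebesgue_row_box n (A : 'I_n -> set R) :
    (forall i, measurable (A i)) ->
  lebesgue_row n [set v : 'rV[R]_n | forall i, A i (v ord0 i)] =
    \prod_(i < n) lebesgue_measure (A i).
Proof.
elim: n A => [|n IH] A mA.
  by rewrite big_ord0 /= diracE mem_set// => -[].
have mB : measurable [set v : 'rV[R]_n | forall i, A (lift ord0 i) (v ord0 i)].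
  rewrite (_ : [set v | _] = \bigcap_(i in [set: 'I_n])
      ((fun v : 'rV[R]_n => v ord0 i) @^-1` A (lift ord0 i))); last first.
    by apply/seteqP; split => v /= h; move=> i; [move=> _|]; apply: h.
  apply: fin_bigcap_measurable => // i _.
  by rewrite -[X in measurable X]setTI; exact: measurable_row_coord.
rewrite big_ord_recl -IH// -lebesgue_consX//; congr (lebesgue_cons _ _).
apply/seteqP; split => v /=.
  by move=> h; split => // i; rewrite mxE.
move=> [h0 hS] i; case: (unliftP ord0 i) => [j|] -> //.
by have := hS j; rewrite mxE.
Qed.

End lebesgue_row.

Section euclidean.
Variables (R : realType) (n : nat).
Implicit Types (x y : 'rV[R]_n) (u : 'rV[R]_n -> R).

(* The library norm `|y| on 'rV[R]_n is the sup norm. *)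
Definition eucl_norm y : R := Num.sqrt (\sum_i y ord0 i ^+ 2).

Definition lp_norm (p : R) y : R := (\sum_i `|y ord0 i| `^ p) `^ p^-1.

Definition unit_sphere : set 'rV[R]_n := [set y | eucl_norm y = 1].

Definition cone (A : set 'rV[R]_n) : set 'rV[R]_n :=
  [set y | exists r, exists2 t, A t & 0 < r <= 1 /\ y = r *: t].

(* The surface measure of the unit sphere, with the normalization of the polar
   coordinates formula: the cone over A has volume sphere_measure A / n. *)
Definition sphere_measure (A : set 'rV[R]_n) : \bar R :=
  (n%:R%:E * lebesgue_row R n (cone A))%E.

Definition sphere_area : R := fine (sphere_measure unit_sphere).

Definition gradient u x : 'rV[R]_n := \row_i 'D_(delta_mx ord0 i) u x.

Definition laplacian u x : R :=
  \sum_i 'D_(delta_mx ord0 i) (fun z => gradient u z ord0 i) x.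

(* For a C^{1,1}_loc function the Laplacian exists in the classical sense only at
   the points (almost all of them) where the gradient is differentiable. *)
Definition twice_differentiable u x :=
  (\forall z \near x, differentiable u z) /\ differentiable (gradient u) x.

Definition C11_loc u :=
  (forall x, differentiable u x) /\
  (forall K, compact K -> [lipschitz gradient u x | x in K]).

Definition truncated_integral (f : 'rV[R]_n -> R) (eps : R) : R :=
  \int[lebesgue_row R n]_(y in [set y | eps < eucl_norm y]) f y.

Definition pv_integrable (f : 'rV[R]_n -> R) :=
  (forall eps, 0 < eps ->
    (lebesgue_row R n).-integrable [set y | eps < eucl_norm y] (EFin \o f)) /\
  cvg (truncated_integral f eps @[eps --> 0^'+]).

Definition pv_integral (f : 'rV[R]_n -> R) : R :=
  lim (truncated_integral f eps @[eps --> 0^'+]).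

Definition increment (K : 'rV[R]_n -> R) u x y : R := (u x - u (x + y)) * K y.

End euclidean.

Section operators.
Variable R : realType.

Definition Gamma (s : R) : R :=
  \int[@lebesgue_measure R]_(t in `]0, +oo[) (t `^ (s - 1) * expR (- t)).

Definition gauss_kernel n (alpha : R) (y : 'rV[R]_n) : R :=
  (Gamma ((2 - alpha) / 2))^-1 *
  (expR (- eucl_norm y ^+ 2) / eucl_norm y `^ (n%:R + alpha)).

Definition gauss_operator n (alpha : R) (u : 'rV[R]_n -> R) x : R :=
  4 * n%:R / sphere_area R n *
  pv_integral (increment (gauss_kernel alpha) u x).

Definition lp_kernel n (p alpha : R) (y : 'rV[R]_n) : R :=
  (2 - alpha) * (lp_norm p y `^ (n%:R + alpha))^-1.

Definition lp_operator n (C p alpha : R) (u : 'rV[R]_n -> R) x : R :=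
  C * pv_integral (increment (lp_kernel p alpha) u x).

End operators.

(* Main.v *)
Require Import Defs.
From HB Require Import structures.
From mathcomp Require Import all_boot all_order all_algebra.
From mathcomp Require Import all_classical all_reals all_analysis.
From mathcomp Require Import fingroup perm measurable_realfun ess_sup_inf ring lra.

Set Implicit Arguments.
Unset Strict Implicit.
Unset Printing Implicit Defensive.

Import Order.TTheory GRing.Theory Num.Theory.
Import numFieldNormedType.Exports.

Local Open Scope classical_set_scope.
Local Open Scope ring_scope.

(** Why the theorem holds.

    Fix x and write S(y) = u(x) - (u(x+y) + u(x-y)) / 2. Both kernels are even,
    so the principal value of the increment against the kernel K is the
    integral of S K: first order terms cancel in pairs. This integral converges
    absolutely, since S is O(|y|^2) near 0 (u is twice differentiable at x) and
    bounded at infinity (u is bounded), while K behaves like |y|^(-n-alpha)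
    near 0, and is at most of that size at infinity, with 0 < alpha < 2. See
    [pv_integral_second_difference].

    As alpha tends to 2 the mass of |y|^2 K concentrates at the origin: the
    normalizing factor of K is comparable to 2 - alpha, which compensates
    exactly the divergence of the integral of |y|^(2-n-alpha) over the unit ball
    and annihilates everything else. Only the quadratic part -Q(y)/2 of S
    survives, where Q is the Hessian form. By sign changes of coordinates the
    integral of y_i y_j K over the unit ball of the p-norm is 0 for i <> j; by
    permutations it is the same for all i = j. So the limit is a negative
    multiple of the trace of the Hessian, which is the Laplacian. This is
    [cvg_second_order], for kernels g(y) N(y)^(-n-alpha) with N a p-norm and g
    an even function with 0 <= g <= 1 and 1 - g <= N^2; the two parts of the theorem are
    the cases g = exp(-N^2), p = 2, and g = 1.

    The exact integrals come from scaling alone ([integral_inner_radial]): if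
    the mass of the ball of radius r is c r^m for every r, then the integral of
    N^(e-m) over the unit ball is c m / e. With G(y) = y_i^2, homogeneous of
    degree 2, this gives c_i (n+2) / (2 - alpha), where c_i is the second moment
    of the ball, hence the constant C c_i (n+2) / 2 > 0 of the second part.

    For the first part the constant is evaluated in two steps. The factor
    1 / Gamma((2-alpha)/2) is asymptotic to (2-alpha)/2, because s Gamma(s)
    tends to 1 as s tends to 0 ([cvg_Gamma_factor]). And for p = 2 computing the
    integral of N^(1-n) over the ball in two ways gives (n+2) c_i = vol(B)
    ([second_moment_eucl]), while the area of the sphere is n vol(B); so the
    prefactor 4n / omega_n turns the limit into minus the Laplacian. *)

(** * Lebesgue measure under signed coordinate changes *)

Section coordinate_maps.
Variables (R : realType) (n : nat).
Local Notation mu := (lebesgue_row R n).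

Lemma coord_le_norm (v : 'rV[R]_n) (i : 'I_n) : `|v ord0 i| <= `|v|.
Proof.
rewrite [leRHS]/Num.Def.normr /= mx_normrE.
exact: (le_bigmax _ (fun ij : 'I_1 * 'I_n => `|v ij.1 ij.2|) (ord0, i)).
Qed.

Definition box (A : 'I_n -> set R) : set 'rV[R]_n :=
  [set v | forall i, A i (v ord0 i)].

Lemma measurable_box (A : 'I_n -> set R) :
  (forall i, measurable (A i)) -> measurable (box A).
Proof.
move=> mA; rewrite (_ : box A = \bigcap_(i in [set: 'I_n])
    ((fun v : 'rV[R]_n => v ord0 i) @^-1` A i)); last first.
  by apply/seteqP; split => v /= h; move=> i; [move=> _|]; apply: h.
apply: fin_bigcap_measurable => // i _.
by rewrite -[X in measurable X]setTI; exact: measurable_row_coord.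
Qed.

Definition measurable_boxes : set (set 'rV[R]_n) :=
  [set B | exists2 A : 'I_n -> set R, (forall i, measurable (A i)) & B = box A].

Lemma measurable_boxesE :
  (measurable : set (set 'rV[R]_n)) = <<s measurable_boxes >>.
Proof.
apply/seteqP; split => [B mB|].
  move: B mB; apply: smallest_sub; first exact: smallest_sigma_algebra.
  rewrite -bigcup_seq => _ [i _ [B mB <-]]; apply: sub_sigma_algebra.
  exists (fun j => if j == i then B else setT) => [j|]; first by case: ifP.
  rewrite setTI; apply/seteqP; split => v /=.
    by move=> Bv j; case: eqP => [->|].
  by move=> /(_ i); rewrite eqxx.
apply: smallest_sub; first exact: sigma_algebra_measurable.
by move=> _ [A mA ->]; exact: measurable_box.
Qed.

Lemma setI_closed_boxes : setI_closed measurable_boxes.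
Proof.
move=> _ _ [A mA ->] [B mB ->]; exists (fun i => A i `&` B i).
  by move=> i; exact: measurableI.
apply/seteqP; split => v /=; first by move=> [Av Bv] i; split.
by move=> h; split => i; have [] := h i.
Qed.

Definition cube (k : nat) : set 'rV[R]_n := box (fun=> `[- k%:R, k%:R]%classic).

(** The boxes with measurable sides form a pi-system generating the
    sigma-algebra, and the cubes exhaust the space; this is what makes every
    product-like identity below a computation on boxes. *)
Lemma eq_measure_boxes (m1 m2 : {measure set 'rV[R]_n -> \bar R}) :
  (forall A : 'I_n -> set R, (forall i, measurable (A i)) ->
    m1 (box A) = m2 (box A)) ->
  (forall k : nat, (m1 (cube k) < +oo)%E) ->
  forall A, measurable A -> m1 A = m2 A.
Proof.
move=> m12 m1oo A mA.
apply: (measure_unique measurable_boxes cube) mA => //.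
- exact: measurable_boxesE.
- exact: setI_closed_boxes.
- by move=> k; exists (fun=> `[- k%:R, k%:R]%classic).
- apply/seteqP; split => // v _.
  exists (Num.trunc `|v|).+1 => // i /=.
  rewrite in_itv /= -ler_norml.
  by rewrite (le_trans (coord_le_norm v i))// ltW// truncnS_gt.
- by move=> _ [B mB ->]; exact: m12.
Qed.


Lemma lebesgue_box (A : 'I_n -> set R) : (forall i, measurable (A i)) ->
  mu (box A) = (\prod_i lebesgue_measure (A i))%E.
Proof. by move=> mA; exact: lebesgue_row_box. Qed.

Lemma cube_lty k : (mu (cube k) < +oo)%E.
Proof.
rewrite /cube lebesgue_box//.
have -> : lebesgue_measure (`[- k%:R, k%:R]%classic : set R) = (k%:R *+ 2)%:E.
  rewrite lebesgue_measure_itv/= lte_fin; case: ifPn.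
    by rewrite -EFinD opprK mulr2n.
  by case: k => [|k]; rewrite ?mul0rn// -subr_gt0 opprK -leNgt -mulr2n pmulrn_lle0// lern0.
by rewrite prodEFin ltry.
Qed.

(** Half-open intervals determine Lebesgue measure on the line; a negative
    factor exchanges the open and the closed end, which has no effect on the
    length. *)
Lemma lebesgue_measureM (a : R) (A : set R) : a != 0 -> measurable A ->
  lebesgue_measure [set t | A (a * t)] = (`|a|^-1%:E * lebesgue_measure A)%E.
Proof.
move=> a0 mA.
have ma : measurable_fun [set: R] ( *%R a : R -> measurableTypeR R).
  by apply: mulrl_measurable.
have r0 : 0 <= `|a| by [].
suff -> : lebesgue_measure A =
    (`|a|%:E * pushforward lebesgue_measure ( *%R a : R -> measurableTypeR R) A)%E.
  by rewrite muleA -EFinM mulVf ?normr_eq0// mul1e.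
unshelve refine (lebesgue_measure_unique (mu := mscale (NngNum r0)
  (pushforward lebesgue_measure ( *%R a : R -> measurableTypeR R))) _ mA).
  exact: ma.
move=> _ [[x y]] /= xy <-.
change (lebesgue_measure `]x, y] =
  `|a|%:E * lebesgue_measure [set t | (a * t \in `]x, y])%R])%E.
have [a_gt0|a_lt0|/eqP] := ltgtP 0 a; last by rewrite eq_sym (negbTE a0).
  have -> : [set t | a * t \in `]x, y]] = `]x / a, y / a]%classic.
    apply/seteqP; split => t /=; rewrite !in_itv/=.
      by rewrite ltr_pdivrMr// ler_pdivlMr// ![t * a]mulrC.
    by rewrite ltr_pdivrMr// ler_pdivlMr// ![t * a]mulrC.
  rewrite !lebesgue_measure_itv/= !lte_fin ltr_pM2r ?invr_gt0//.
  case: ifPn => _; last by rewrite mule0.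
  by rewrite -!EFinD -EFinM gtr0_norm// -mulrBl mulrCA mulfV// mulr1.
have -> : [set t | a * t \in `]x, y]] = `[y / a, x / a[%classic.
  by apply/seteqP; split => t /=; rewrite !in_itv/=;
     rewrite ltr_ndivlMr// ler_ndivrMr// ![t * a]mulrC andbC.
rewrite !lebesgue_measure_itv/= !lte_fin ltr_nM2r ?invr_lt0//.
case: ifPn => _; last by rewrite mule0.
by rewrite -!EFinD -EFinM ltr0_norm// -mulrBl mulrCA mulNr mulfV// mulrN1 opprB.
Qed.

(** One family of linear maps covers dilations, reflections, sign changes of a
    single coordinate and permutations of the coordinates: they all send boxes
    to boxes, so that no general change of variables formula is called for. *)
Definition coord_map (a : 'I_n -> R) (s : 'S_n) (y : 'rV[R]_n) : 'rV[R]_n :=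
  \row_i (a i * y ord0 (s i)).

Lemma measurable_coord_map a s : measurable_fun setT (coord_map a s).
Proof.
apply: measurable_fun_row => i.
rewrite (_ : (fun _ => _) = (fun y : 'rV[R]_n => a i * y ord0 (s i))); last first.
  by apply/funext => y; rewrite mxE.
by apply: measurable_funM => //; exact: measurable_row_coord.
Qed.

(** The preimage of a box is the box with rescaled and permuted sides, so both
    sides agree on boxes. *)
Lemma lebesgue_row_coord_map a s (A : set 'rV[R]_n) :
  (forall i, a i != 0) -> measurable A ->
  mu (coord_map a s @^-1` A) = ((\prod_i `|a i|)^-1%:E * mu A)%E.
Proof.
move=> a0 mA.
have P0 : 0 <= (\prod_i `|a i|)^-1 by rewrite invr_ge0 prodr_ge0.
rewrite -[RHS]/(mscale (NngNum P0) mu A).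
rewrite -[LHS]/(pushforward mu (coord_map a s) A).
have eq_box (B : 'I_n -> set R) : (forall i, measurable (B i)) ->
  pushforward mu (coord_map a s) (box B) = mscale (NngNum P0) mu (box B).
  move=> mB; rewrite /pushforward/= /mscale/=.
  rewrite [X in _ = (_ * X)%E](lebesgue_box mB).
  pose C i : set R := [set t | B ((s^-1)%g i) (a ((s^-1)%g i) * t)].
  have mC i : measurable (C i).
    by rewrite -[X in measurable X]setTI; exact: mulrl_measurable.
  have -> : coord_map a s @^-1` box B = box C.
    apply/seteqP; split => y /= h i.
      by have := h ((s^-1)%g i); rewrite mxE permKV.
    by have := h (s i); rewrite mxE /C/= permK.
  rewrite (lebesgue_box mC) (reindex_inj (@perm_inj _ s)) /=.
  under eq_bigr => i _ do rewrite /C permK lebesgue_measureM//.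
  rewrite big_split /= prodEFin prodfV//.
unshelve refine (eq_measure_boxes (m1 := pushforward mu (coord_map a s))
   (m2 := mscale (NngNum P0) mu) eq_box _ mA).
  exact: measurable_coord_map.
move=> k.
have E := eq_box (fun=> `[- k%:R, k%:R]%classic) (fun=> measurable_itv _).
apply: (@eq_ind_r _ _ (fun z => z < +oo)%E _ _ E).
by rewrite /mscale/= lte_mul_pinfty// cube_lty.
Qed.
End coordinate_maps.

Section change_of_variables.
Variables (R : realType) (n : nat).
Local Notation mu := (lebesgue_row R n).
Local Open Scope ereal_scope.
Implicit Types (a : 'I_n -> R) (s : {perm 'I_n}).

Lemma ge0_integral_coord_map a s (D : set 'rV[R]_n) (f : 'rV[R]_n -> \bar R) :
  (forall i, a i != 0%R) -> measurable D -> measurable_fun D f ->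
  (forall y, D y -> 0 <= f y) ->
  \int[mu]_(y in coord_map a s @^-1` D) f (coord_map a s y) =
  ((\prod_i `|a i|)^-1)%:E * \int[mu]_(y in D) f y.
Proof.
move=> a0 mD mf f0.
have P0 : (0 <= (\prod_i `|a i|)^-1)%R by rewrite invr_ge0 prodr_ge0.
have mphi := measurable_coord_map a s.
rewrite -[LHS](ge0_integral_pushforward mphi mu mD mf); last first.
by move=> y; rewrite in_setE; exact: f0.
rewrite -[RHS](ge0_integral_mscale mu mD (NngNum P0) mf f0).
by apply: eq_measure_integral => // A mA _; exact: lebesgue_row_coord_map.
Qed.

(** Stated for functions of arbitrary sign, integrable or not: the
    nonnegative case applies to the positive and to the negative part. *)
Lemma integral_coord_isometry a s (D : set 'rV[R]_n) (f : 'rV[R]_n -> \bar R) :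
  (forall i, `|a i| = 1)%R -> measurable D -> measurable_fun D f ->
  \int[mu]_(y in coord_map a s @^-1` D) f (coord_map a s y) =
  \int[mu]_(y in D) f y.
Proof.
move=> a1 mD mf.
have a0 i : a i != 0%R by rewrite -normr_eq0 a1 oner_eq0.
have P1 : (\prod_i `|a i|)^-1%R = 1%R by rewrite big1 ?invr1.
rewrite integralE [RHS]integralE.
congr (_ - _); rewrite -[RHS]mul1e -{1}P1 -(ge0_integral_coord_map s a0 mD)//.
- by under eq_integral do rewrite funepos_comp.
- exact: measurable_funepos.
- by under eq_integral do rewrite funeneg_comp.
- exact: measurable_funeneg.
Qed.

End change_of_variables.

(** * The p-norms of row vectors *)

Section lp_norm.
Variables (R : realType) (n : nat) (p : R).
Hypothesis p1 : 1 <= p.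
Implicit Types y : 'rV[R]_n.
Local Notation N := (@lp_norm R n p).

Let p0 : 0 < p. Proof. exact: lt_le_trans p1. Qed.

Lemma lp_norm_ge0 y : 0 <= N y. Proof. exact: powR_ge0. Qed.

Lemma lp_normZ (a : R) y : N (a *: y) = `|a| * N y.
Proof.
rewrite /lp_norm; under eq_bigr => i _ do rewrite mxE normrM powRM//.
rewrite -mulr_sumr powRM ?powR_ge0 ?sumr_ge0//.
by rewrite -powRrM mulfV ?gt_eqF// powRr1.
Qed.

Lemma lp_normN y : N (- y) = N y.
Proof. by congr (_ `^ _); apply: eq_bigr => i _; rewrite mxE normrN. Qed.

Lemma lp_norm_coord_map (a : 'I_n -> R) (s : {perm 'I_n}) y :
  (forall i, `|a i| = 1) -> N (coord_map a s y) = N y.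
Proof.
move=> a1; rewrite /lp_norm; congr (_ `^ _).
rewrite [RHS](reindex_inj (@perm_inj _ s)); apply: eq_bigr => i _.
by rewrite mxE normrM a1 mul1r.
Qed.

Lemma coord_le_lp_norm y i : `|y ord0 i| <= N y.
Proof.
have -> : `|y ord0 i| = (`|y ord0 i| `^ p) `^ p^-1.
  by rewrite -powRrM mulfV ?gt_eqF// powRr1.
rewrite ge0_ler_powR ?invr_ge0 ?(ltW p0)// ?nnegrE ?powR_ge0 ?sumr_ge0//.
by rewrite (bigD1 i)//= lerDl sumr_ge0.
Qed.

Lemma norm_le_lp_norm y : `|y| <= N y.
Proof.
have [->|/mx_norm_neq0[ij]] := eqVneq `|y| 0; first exact: lp_norm_ge0.
rewrite [leLHS]/Num.Def.normr/= => ->; rewrite ord1; exact: coord_le_lp_norm.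
Qed.

(** The sharp constant is the p-th root of the dimension; the dimension itself
    is enough here and has the same form for all p. *)
Lemma lp_norm_le_norm y : N y <= n%:R * `|y|.
Proof.
have [n0|n_gt0] := posnP n.
  rewrite /lp_norm big1 ?powR0 ?mulr_ge0 ?invr_eq0 ?gt_eqF// => i.
  by have := ltn_ord i; rewrite {2}n0.
apply: (@le_trans _ _ ((n%:R * `|y| `^ p) `^ p^-1)).
  rewrite ge0_ler_powR ?invr_ge0 ?(ltW p0)// ?nnegrE ?mulr_ge0 ?powR_ge0 ?sumr_ge0//.
  rewrite -[X in X%:R]card_ord mulr_natl -sumr_const ler_sum// => i _.
  by rewrite ge0_ler_powR ?nnegrE ?(ltW p0)// coord_le_norm.
rewrite powRM ?powR_ge0// -powRrM mulfV ?gt_eqF// powRr1// ler_wpM2r//.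
by rewrite ler1_powR ?ler1n// invf_le1.
Qed.

Lemma lp_norm_gt0 y : (0 < N y) = (y != 0).
Proof.
have [->|y0] := eqVneq y 0; first by rewrite -(scale0r y) lp_normZ normr0 mul0r ltxx.
by rewrite (lt_le_trans _ (norm_le_lp_norm y))// normr_gt0.
Qed.

Lemma measurable_lp_norm : measurable_fun setT N.
Proof.
apply: (measurableT_comp (measurable_powR _)).
apply: measurable_sum => i.
apply: (measurableT_comp (measurable_powR _)).
apply: measurableT_comp => //; exact: measurable_row_coord.
Qed.

End lp_norm.

Lemma eucl_normE (R : realType) n (y : 'rV[R]_n) : eucl_norm y = lp_norm 2 y.
Proof.
rewrite /eucl_norm /lp_norm -powR12_sqrt ?sumr_ge0// => [|i _]; last exact: sqr_ge0.
congr (_ `^ _); apply: eq_bigr => i _.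
by rewrite powR_mulrn// real_normK// num_real.
Qed.

Lemma measurable_eucl_norm (R : realType) (n : nat) :
  measurable_fun setT (@eucl_norm R n).
Proof.
rewrite (_ : @eucl_norm R n = @lp_norm R n 2); first exact: measurable_lp_norm.
by apply/funext => y; exact: eucl_normE.
Qed.

Lemma measurable_eucl_exterior (R : realType) (n : nat) (eps : R) :
  measurable [set y : 'rV[R]_n | eps < eucl_norm y].
Proof.
have -> : [set y : 'rV[R]_n | eps < eucl_norm y] =
    @eucl_norm R n @^-1` `]eps, +oo[%classic.
  by apply/seteqP; split => y /=; rewrite in_itv/= andbT.
by rewrite -[X in measurable X]setTI; exact: measurable_eucl_norm.
Qed.

(** * Integrals of powers of a radius *)

Section radial_integrals.
Context d (T : measurableType d) (R : realType) (mu : {measure set T -> \bar R}).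
Local Open Scope ereal_scope.

Lemma nneseries_geometric (A z : R) : (0 <= z < 1)%R ->
  \sum_(0 <= k <oo) (A * z ^+ k)%:E = (A / (1 - z))%:E.
Proof.
move=> /andP[z0 z1]; apply/cvg_lim => //.
rewrite (_ : (fun _ => _) = EFin \o series (geometric A z)); last first.
  by apply/funext => k /=; rewrite sumEFin.
by apply: cvg_EFin; [exact: nearW|apply: cvg_geometric_series; rewrite ger0_norm].
Qed.

Section shells.
Variables (S : (set T)^nat) (f : T -> \bar R) (A z : R).
Hypotheses (mS : forall k, measurable (S k)) (tS : trivIset setT S).
Hypotheses (mf : measurable_fun (\bigcup_k S k) f).
Hypotheses (f0 : forall x, (\bigcup_k S k) x -> 0 <= f x).
Hypotheses (A0 : (0 <= A)%R) (z01 : (0 <= z < 1)%R).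

Lemma integral_shells_le :
  (forall k, \int[mu]_(x in S k) f x <= (A * z ^+ k)%:E) ->
  \int[mu]_(x in \bigcup_k S k) f x <= (A / (1 - z))%:E.
Proof.
move=> h; rewrite ge0_integral_bigcup// -nneseries_geometric//.
apply: lee_nneseries => // k _ _; apply: integral_ge0 => x Sx.
by apply: f0; exists k.
Qed.

Lemma integral_shells_ge :
  (forall k, (A * z ^+ k)%:E <= \int[mu]_(x in S k) f x) ->
  (A / (1 - z))%:E <= \int[mu]_(x in \bigcup_k S k) f x.
Proof.
move=> h; rewrite ge0_integral_bigcup// -nneseries_geometric//.
apply: lee_nneseries => // k _ _; rewrite lee_fin.
by case/andP : z01 => z0 _; rewrite mulr_ge0// exprn_ge0.
Qed.

End shells.

(** Polar coordinates in the only form used below. A radius N and a density G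
    are given such that the mass of the ball of radius r is c r^m. Cutting
    into geometric shells evaluates the integrals of powers of N without
    introducing a surface measure; the same argument serves on the line (for
    Gamma) and on row vectors. *)
Section radial.
Variables (N G : T -> R) (c m : R).
Hypotheses (mN : measurable_fun setT N) (mG : measurable_fun setT G).
Hypotheses (G0 : forall x, (0 <= G x)%R) (m0 : (0 < m)%R).
Hypothesis ballE : forall r : R, (0 < r)%R ->
  \int[mu]_(x in [set x | (0 < N x <= r)%R]) (G x)%:E = (c * r `^ m)%:E.

Definition shell (a b : R) : set T := [set x | (a < N x <= b)%R].

Lemma measurable_shell a b : measurable (shell a b).
Proof.
rewrite (_ : shell a b = N @^-1` `]a, b]%classic); last first.
  by apply/seteqP; split => x /=; rewrite in_itv.
by rewrite -[X in measurable X]setTI; exact: mN.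
Qed.

Let mGE (D : set T) : measurable_fun D (EFin \o G).
Proof. by apply: measurable_funTS; exact/measurable_EFinP. Qed.

Lemma radial_mass_ge0 : (0 <= c)%R.
Proof.
have := ballE ltr01; rewrite powR1 mulr1 -lee_fin => <-.
by apply: integral_ge0 => x _; rewrite lee_fin.
Qed.

Lemma integral_shell a b : (0 < a <= b)%R ->
  \int[mu]_(x in shell a b) (G x)%:E = (c * (b `^ m - a `^ m))%:E.
Proof.
move=> /andP[a0 ab]; have b0 := lt_le_trans a0 ab.
have bE : shell 0 b = shell 0 a `|` shell a b.
  apply/seteqP; split => x; rewrite /shell/=.
    by move=> /andP[-> ->]/=; rewrite andbT; case: leP => _; [left|right].
  move=> [/andP[-> h]|/andP[h ->]]; first by rewrite (le_trans h).
  by rewrite (lt_trans a0).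
have := ballE b0; rewrite -/(shell 0 b) bE ge0_integral_setU//; last 4 first.
- exact: measurable_shell.
- exact: measurable_shell.
- by move=> x _; rewrite lee_fin.
- apply/disj_setPS => x [] /=; rewrite /shell/= => /andP[_ h1] /andP[h2 _].
  by move: (lt_le_trans h2 h1); rewrite ltxx.
rewrite -/(shell 0 a) ballE// => h.
rewrite mulrBr EFinB -h addeAC subee// add0e//.
Qed.

Lemma powR_expR (a x : R) : (expR x `^ a = expR (a * x))%R.
Proof. by rewrite -expRM mulrC. Qed.

Lemma powR_lnE (a x : R) : (0 < x)%R -> (x `^ a = expR (a * ln x))%R.
Proof. by move=> x0; rewrite /powR gt_eqF. Qed.

Lemma measurable_radial (D : set T) (s : R) :
  measurable_fun D (fun x => (G x * N x `^ s)%:E).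
Proof.
apply: measurable_funTS; apply/measurable_EFinP; apply: measurable_funM => //.
exact: (measurableT_comp (measurable_powR _)).
Qed.

Section near_zero.
Variables (e t : R).
Hypotheses (e0 : (0 < e)%R) (t0 : (0 < t)%R).

Definition inner_shell (k : nat) := shell (expR (- (t * k.+1%:R))) (expR (- (t * k%:R))).

Lemma measurable_inner_shell k : measurable (inner_shell k).
Proof. by rewrite /inner_shell; exact: measurable_shell. Qed.

Lemma bigcup_inner_shell : \bigcup_k inner_shell k = shell 0 1.
Proof.
apply/seteqP; split => [x [k _]|x].
  rewrite /inner_shell /shell/= => /andP[h1 h2].
  rewrite (lt_trans _ h1) ?expR_gt0//= (le_trans h2)//.
  by rewrite -expR0 ler_expR oppr_le0 mulr_ge0// ltW.
rewrite /shell/= => /andP[N0 N1].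
have lN : (0 <= - ln (N x) / t)%R by rewrite divr_ge0 ?oppr_ge0 ?ln_le0// ltW.
(* The index of the shell is the integer part of -ln N / t. *)
exists (Num.trunc (- ln (N x) / t)) => //.
have /andP[h1 h2] := truncn_itv lN.
rewrite /inner_shell /shell/= -[X in (X <= _)%R]lnK ?posrE// -[X in (_ < X)%R]lnK ?posrE//.
rewrite ltr_expR ler_expR lerNr ltrNl [(t * _)%R]mulrC [(t * _)%R]mulrC.
by rewrite -ltr_pdivrMr// h2 -ler_pdivlMr.
Qed.

Lemma trivIset_inner_shell : trivIset setT inner_shell.
Proof.
apply: ltn_trivIset => i j ij; apply/seteqP; split => // x [].
rewrite /inner_shell /shell/= => /andP[h1 _] /andP[_ h2].
move: (lt_le_trans h1 h2); rewrite ltr_expR ltrN2 ltr_pM2l// ltr_nat.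
by rewrite ltnS leqNgt ij.
Qed.

Lemma integral_inner_shell k :
  \int[mu]_(x in inner_shell k) (G x)%:E = (c * (1 - expR (- (m * t))) * expR (- (m * t)) ^+ k)%:E.
Proof.
rewrite integral_shell; last first.
  by rewrite expR_gt0 ler_expR lerN2 ler_wpM2l ?ler_nat// ltW.
congr EFin; rewrite !powR_expR -expRM_natr -mulrA mulrBl mul1r -expRD.
by congr (_ * (expR _ - expR _))%R; rewrite -?natr1; ring.
Qed.

(** On a shell of ratio exp(-t), the factor N^(e-m) oscillates by at most
    exp((m+e) t), so the sum over the shells is a geometric series. The
    elementary inequality 1 + y <= exp y turns its sum into a bound that is
    continuous in t at t = 0. *)
Lemma inner_radial_le :
  \int[mu]_(x in shell 0 1) (G x * N x `^ (e - m))%:E <=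
  (expR (m * t) * (c * m / e) * (1 + e * t))%:E.
Proof.
have c0 := radial_mass_ge0.
have z1 : (0 <= expR (- (e * t)) < 1)%R.
  by rewrite expR_ge0/= -expR0 ltr_expR oppr_lt0 mulr_gt0.
pose A := (expR (m * t) * (c * (1 - expR (- (m * t)))))%R.
have A0 : (0 <= A)%R.
  rewrite !mulr_ge0 ?expR_ge0// subr_ge0 -expR0 ler_expR oppr_le0.
  by rewrite mulr_ge0// ltW.
apply: (@le_trans _ _ (A / (1 - expR (- (e * t))))%:E).
  rewrite -bigcup_inner_shell; apply: integral_shells_le => //.
  - by move=> k; exact: measurable_inner_shell.
  - exact: trivIset_inner_shell.
  - exact: measurable_radial.
  - by move=> x _; rewrite lee_fin mulr_ge0// powR_ge0.
  move=> k.
  apply: (@le_trans _ _ (\int[mu]_(x in inner_shell k)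
      ((expR (m * (t * k.+1%:R) - e * (t * k%:R)))%:E * (G x)%:E))).
    apply: ge0_le_integral => //.
    - exact: measurable_inner_shell.
    - by move=> x _; rewrite lee_fin mulr_ge0// powR_ge0.
    - exact: measurable_radial.
    - by apply: measurable_funeM; exact: mGE.
    move=> x; rewrite /inner_shell /shell/= => /andP[h1 h2].
    have N0 : (0 < N x)%R by rewrite (lt_trans _ h1)// expR_gt0.
    rewrite -EFinM lee_fin mulrC ler_wpM2r// powR_lnE// ler_expR.
    move: h1 h2; rewrite -[N x]lnK ?posrE// ltr_expR ler_expR lnK ?posrE// => h1 h2.
    have := ler_wpM2l (ltW e0) h2; have := ler_wpM2l (ltW m0) (ltW h1); lra.
  rewrite ge0_integralZl_EFin ?expR_ge0//; last 2 first.
  - exact: measurable_inner_shell.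
  - by move=> x _; rewrite lee_fin.
  rewrite integral_inner_shell -EFinM lee_fin le_eqVlt; apply/orP; left; apply/eqP.
  rewrite /A -!expRM_natr.
  have -> : (m * (t * k.+1%:R) - e * (t * k%:R) =
      m * t + - (e * t) * k%:R - (- (m * t)) * k%:R)%R by rewrite -natr1; ring.
  by rewrite [expR (_ - _)]expRB expRD; field; rewrite gt_eqF// expR_gt0.
rewrite lee_fin /A -!mulrA ler_wpM2l ?expR_ge0// ler_wpM2l//.
have et0 : (0 < e * t)%R by rewrite mulr_gt0.
rewrite ler_pdivrMr; last by rewrite subr_gt0; case/andP : z1.
apply: (@le_trans _ _ (m * t)%R).
  by have := expR_ge1Dx (- (m * t)); lra.
rewrite -!mulrA ler_pM2l// ler_pdivlMl//.
have h : (expR (- (e * t)) * (1 + e * t) <= 1)%R.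
  by rewrite expRN ler_pdivrMl ?expR_gt0// mulr1 expR_ge1Dx.
by rewrite mulrBr mulr1 [X in (_ - X)%R]mulrC; lra.
Qed.

(** Companion lower bound, multiplied out so that it is also continuous at
    t = 0. *)
Lemma inner_radial_ge :
  (c * m / e)%:E <=
  (expR (e * t) * (1 + m * t))%:E *
  \int[mu]_(x in shell 0 1) (G x * N x `^ (e - m))%:E.
Proof.
have c0 := radial_mass_ge0.
have z1 : (0 <= expR (- (e * t)) < 1)%R.
  by rewrite expR_ge0/= -expR0 ltr_expR oppr_lt0 mulr_gt0.
pose A := (expR (- (e * t)) * (c * (1 - expR (- (m * t)))))%R.
have A0 : (0 <= A)%R.
  rewrite !mulr_ge0 ?expR_ge0// subr_ge0 -expR0 ler_expR oppr_le0.
  by rewrite mulr_ge0// ltW.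
have mt0 : (0 < m * t)%R by rewrite mulr_gt0.
have et0 : (0 < e * t)%R by rewrite mulr_gt0.
apply: (@le_trans _ _ ((expR (e * t) * (1 + m * t)) * (A / (1 - expR (- (e * t)))))%:E).
  rewrite lee_fin mulrA ler_pdivlMr; last by rewrite subr_gt0; case/andP : z1.
  have -> : (expR (e * t) * (1 + m * t) * A = c * ((1 - expR (- (m * t))) * (1 + m * t)))%R.
    by rewrite /A expRN; field; rewrite gt_eqF// expR_gt0.
  rewrite -!mulrA ler_wpM2l//.
  apply: (@le_trans _ _ (m * t)%R).
    rewrite ler_pM2l// ler_pdivrMl//.
    by have := expR_ge1Dx (- (e * t)); lra.
  have h : (expR (- (m * t)) * (1 + m * t) <= 1)%R.
    by rewrite expRN ler_pdivrMl ?expR_gt0// mulr1 expR_ge1Dx.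
  by rewrite mulrBl mul1r; lra.
rewrite EFinM lee_pmul2l//; last first.
  by rewrite lte_fin mulr_gt0 ?expR_gt0// addr_gt0.
rewrite -bigcup_inner_shell; apply: integral_shells_ge => //.
- by move=> k; exact: measurable_inner_shell.
- exact: trivIset_inner_shell.
- exact: measurable_radial.
- by move=> x _; rewrite lee_fin mulr_ge0// powR_ge0.
move=> k.
apply: (@le_trans _ _ (\int[mu]_(x in inner_shell k)
    ((expR (m * (t * k%:R) - e * (t * k.+1%:R)))%:E * (G x)%:E))).
  rewrite ge0_integralZl_EFin ?expR_ge0//; last 2 first.
  - exact: measurable_inner_shell.
  - by move=> x _; rewrite lee_fin.
  rewrite integral_inner_shell -EFinM lee_fin le_eqVlt; apply/orP; left; apply/eqP.
  rewrite /A -!expRM_natr.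
  have -> : (m * (t * k%:R) - e * (t * k.+1%:R) =
      - (e * t) + - (e * t) * k%:R - (- (m * t)) * k%:R)%R by rewrite -natr1; ring.
  by rewrite [expR (_ - _)]expRB expRD; field; rewrite gt_eqF// expR_gt0.
apply: ge0_le_integral => //.
- exact: measurable_inner_shell.
- by move=> x _; rewrite -EFinM lee_fin mulr_ge0// expR_ge0.
- by apply: measurable_funeM; exact: mGE.
- exact: measurable_radial.
move=> x; rewrite /inner_shell /shell/= => /andP[h1 h2].
have N0 : (0 < N x)%R by rewrite (lt_trans _ h1)// expR_gt0.
rewrite -EFinM lee_fin [leRHS]mulrC ler_wpM2r// powR_lnE// ler_expR.
move: h1 h2; rewrite -[N x]lnK ?posrE// ltr_expR ler_expR lnK ?posrE// => h1 h2.
have := ler_wpM2l (ltW e0) (ltW h1); have := ler_wpM2l (ltW m0) h2; lra.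
Qed.

End near_zero.
(** The two bounds hold for every ratio exp(-t) and close up on c m / e when t
    tends to 0. In particular e times the integral does not depend on e: this
    is why the factor 2 - alpha is the right normalization of the kernels. *)
Lemma integral_inner_radial (e : R) : (0 < e)%R ->
  \int[mu]_(x in [set x | (0 < N x <= 1)%R]) (G x * N x `^ (e - m))%:E =
  (c * m / e)%:E.
Proof.
move=> e0; set I := LHS.
have I0 : 0 <= I by apply: integral_ge0 => x _; rewrite lee_fin mulr_ge0// powR_ge0.
have Ile t : (0 < t)%R -> I <= (expR (m * t) * (c * m / e) * (1 + e * t))%:E.
  exact: inner_radial_le.
have Ige t : (0 < t)%R -> (c * m / e)%:E <= (expR (e * t) * (1 + m * t))%:E * I.
  exact: inner_radial_ge.
have Ifin : I \is a fin_num by rewrite ge0_fin_numE// (le_lt_trans (Ile 1%R ltr01))// ltry.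
move: Ile Ige; rewrite -(fineK Ifin); move: (fine I) => J Ile Ige; congr EFin.
have cE (a b v : R) : (expR (a * t) * v * (1 + b * t))%R @[t --> (0%R : R)^'+] --> v.
  rewrite -[X in _ --> X](_ : expR (a * 0) * v * (1 + b * 0) = v)%R; last first.
    by rewrite !mulr0 expR0 addr0 mul1r mulr1.
  apply: cvg_at_right_filter; apply: cvgM; last first.
    by apply: cvgD; [exact: cvg_cst|apply: cvgM; [exact: cvg_cst|exact: cvg_id]].
  apply: cvgM; last exact: cvg_cst.
  apply: (@cvg_comp _ _ _ (fun t => a * t)%R); last exact: continuous_expR.
  by apply: cvgM; [exact: cvg_cst|exact: cvg_id].
apply/eqP; rewrite eq_le; apply/andP; split.
  apply: (cvgr_to_ge (cE m e (c * m / e)%R)).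
  by near=> t; rewrite -lee_fin; apply: Ile.
apply: (cvgr_to_ge (cE e m J)).
near=> t; rewrite -lee_fin; have := Ige t; rewrite -EFinM => h.
by rewrite [X in (_ <= X%:E)%E]mulrAC; apply: h.
Unshelve. all: by end_near. Qed.

Definition outer_shell (k : nat) := shell (expR k%:R) (expR k.+1%:R).

Lemma measurable_outer_shell k : measurable (outer_shell k).
Proof. by rewrite /outer_shell; exact: measurable_shell. Qed.

Lemma bigcup_outer_shell : \bigcup_k outer_shell k = [set x | (1 < N x)%R].
Proof.
apply/seteqP; split => [x [k _]|x /= N1].
  rewrite /outer_shell /shell/= => /andP[h1 _].
  by rewrite (le_lt_trans _ h1)// -expR0 ler_expR.
have N0 : (0 < N x)%R by rewrite (lt_trans _ N1).
have ex : exists k : nat, (N x <= expR k%:R)%R.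
  exists (Num.trunc (ln (N x))).+1.
  by rewrite -{1}[N x]lnK ?posrE// ler_expR ltW// truncnS_gt.
case: (ex_minnP ex) => -[|k] hk kmin.
  by move: hk; rewrite expR0 leNgt N1.
exists k => //; rewrite /outer_shell /shell/= hk andbT ltNge.
by apply/negP => /kmin; rewrite ltnn.
Qed.

Lemma trivIset_outer_shell : trivIset setT outer_shell.
Proof.
apply: ltn_trivIset => i j ij; apply/seteqP; split => // x [].
rewrite /outer_shell /shell/= => /andP[_ h1] /andP[h2 _].
move: (lt_le_trans h2 h1); rewrite ltr_expR ltr_nat.
by rewrite ltnS leqNgt ij.
Qed.

(** Shells of ratio e are fine enough here, as only finiteness, locally
    uniform in a, matters. *)
Lemma integral_outer_radial_le (a : R) : (0 < a)%R ->
  \int[mu]_(x in [set x | (1 < N x)%R]) (G x * N x `^ (- a - m))%:E <=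
  (c * expR m / (1 - expR (- a)))%:E.
Proof.
move=> a0; have c0 := radial_mass_ge0.
have z1 : (0 <= expR (- a) < 1)%R.
  by rewrite expR_ge0/= -expR0 ltr_expR oppr_lt0.
rewrite -bigcup_outer_shell; apply: integral_shells_le => //.
- by move=> k; exact: measurable_outer_shell.
- exact: trivIset_outer_shell.
- exact: measurable_radial.
- by move=> x _; rewrite lee_fin mulr_ge0// powR_ge0.
move=> k.
apply: (@le_trans _ _ (\int[mu]_(x in outer_shell k)
    ((expR ((- a - m) * k%:R))%:E * (G x)%:E))).
  apply: ge0_le_integral => //.
  - exact: measurable_outer_shell.
  - by move=> x _; rewrite lee_fin mulr_ge0// powR_ge0.
  - exact: measurable_radial.
  - by apply: measurable_funeM; exact: mGE.
  move=> x; rewrite /outer_shell /shell/= => /andP[h1 h2].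
  have N0 : (0 < N x)%R by rewrite (lt_trans _ h1)// expR_gt0.
  rewrite -EFinM lee_fin mulrC ler_wpM2r// powR_lnE// ler_expR.
  move: h1; rewrite -[N x]lnK ?posrE// ltr_expR lnK ?posrE// => h1.
  by rewrite ler_wnM2l ?(ltW h1)// -opprD oppr_le0 ltW// addr_gt0.
rewrite ge0_integralZl_EFin ?expR_ge0//; last 2 first.
- exact: measurable_outer_shell.
- by move=> x _; rewrite lee_fin.
rewrite integral_shell; last by rewrite expR_gt0 ler_expR ler_nat/=.
rewrite -EFinM lee_fin -expRM_natr !powR_expR.
have -> : ((- a - m) * k%:R = - a * k%:R - m * k%:R)%R by ring.
have -> : (expR (m * k.+1%:R) = expR m * expR (m * k%:R))%R.
  by rewrite -expRD -natr1; congr expR; ring.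
rewrite expRB; have E0 := expR_gt0 (m * k%:R); have Ea0 := expR_ge0 (- a * k%:R).
apply: (@le_trans _ _ (c * expR (- a * k%:R) * (expR m - 1))%R).
  by rewrite le_eqVlt; apply/orP; left; apply/eqP; field; rewrite gt_eqF.
by rewrite mulrAC ler_wpM2r// ler_wpM2l// lerBlDr lerDl.
Qed.

End radial.
End radial_integrals.

(** * The Gamma function near zero *)

Section gamma.
Variable R : realType.
Local Notation leb := (@lebesgue_measure R).
Local Open Scope ereal_scope.

Let ballE (r : R) : (0 < r)%R ->
  \int[leb]_(t in [set t : R | (0 < idfun t <= r)%R]) (cst 1%R t)%:E = (1 * r `^ 1)%:E.
Proof.
move=> r0; rewrite (_ : [set t | _] = `]0%R, r]%classic); last first.
  by apply/seteqP; split => t /=; rewrite in_itv.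
transitivity (\int[leb]_(t in `]0%R, r]) (cst 1%:E t)) => //.
rewrite integral_cst// mul1e mul1r powRr1 ?ltW//.
have := lebesgue_measure_itv `]0%R, r]; rewrite /= lte_fin r0 oppr0 adde0; exact.
Qed.

Lemma integral_unit_powR (s : R) : (0 < s)%R ->
  \int[leb]_(t in [set t : R | (0 < t <= 1)%R]) (t `^ (s - 1))%:E = (s^-1)%:E.
Proof.
move=> s0; have := integral_inner_radial (mu := leb) (N := idfun) (G := cst 1%R)
  (@measurable_id _ _ _) (@measurable_cst _ _ _ _ _ _) (fun=> ler01) ltr01 ballE s0.
by rewrite mulr1 div1r => <-; apply: eq_integral => t _; rewrite mul1r.
Qed.

(** For t > 1, exp(-t) <= 4 / t^2, which is a power covered by the radial
    bound. *)
Lemma integral_tail_expR : exists K : R, forall s : R, (s <= 1)%R ->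
  \int[leb]_(t in [set t : R | (1 < t)%R]) (t `^ (s - 1) * expR (- t))%:E <= K%:E.
Proof.
pose K := (1 * expR 1 / (1 - expR (- 1)) : R)%R.
exists (4 * K)%R => s s1.
have := integral_outer_radial_le (mu := leb) (N := idfun) (G := cst 1%R)
  (@measurable_id _ _ _) (@measurable_cst _ _ _ _ _ _) (fun=> ler01) ltr01 ballE ltr01.
rewrite -/K => hK.
have mD : measurable [set t : R | (1 < t)%R].
  rewrite (_ : [set t | _] = `]1%R, +oo[%classic)//.
  by apply/seteqP; split => t /=; rewrite in_itv/= andbT.
apply: (@le_trans _ _ (\int[leb]_(t in [set t : R | (1 < t)%R])
    (4%:E * (t `^ (- 1 - 1))%:E))); last first.
  rewrite ge0_integralZl_EFin//; last 2 first.
  - by move=> t _; rewrite lee_fin powR_ge0.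
  - by apply: measurable_funTS; apply/measurable_EFinP; exact: measurable_powR.
  rewrite EFinM lee_pmul2l//; apply: le_trans hK.
  by under [leRHS]eq_integral do rewrite mul1r.
apply: ge0_le_integral => //.
- by move=> t _; rewrite lee_fin mulr_ge0 ?powR_ge0 ?expR_ge0.
- apply: measurable_funTS; apply/measurable_EFinP; apply: measurable_funM.
    exact: measurable_powR.
  by apply: measurableT_comp => //; exact: measurable_oppr.
- apply: measurable_funTS; apply: measurable_funeM; apply/measurable_EFinP; exact: measurable_powR.
move=> t /= t1; rewrite -EFinM lee_fin.
have t0 : (0 < t)%R by rewrite (lt_trans _ t1).
apply: (@le_trans _ _ (expR (- t))).
  by rewrite ler_piMl ?expR_ge0// -[leRHS](powRr0 t) ler_powR ?(ltW t1)// subr_le0.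
have -> : (- 1 - 1 = - 2%:R :> R)%R by ring.
rewrite powR_invn ?(ltW t0)// expRN -[leLHS]mul1r ler_pdivrMr ?expR_gt0//.
rewrite mulrAC ler_pdivlMr ?exprn_gt0// mul1r.
(* Squaring exp(t/2) >= t/2 gives t^2 <= 4 exp t. *)
have -> : (expR t = expR (t / 2) ^+ 2)%R by rewrite -expRM_natr; congr expR; field.
have h : (t / 2 <= expR (t / 2))%R by have := expR_ge1Dx (t / 2)%R; lra.
have h0 : (0 <= t / 2)%R by rewrite divr_ge0 ?ltW.
have : ((t / 2) ^+ 2 <= expR (t / 2) ^+ 2)%R by rewrite lerXn2r// nnegrE ?expR_ge0.
by lra.
Qed.

(** Near 0 the factor exp(-t) lies between 1 - t and 1, so that the integral
    over the unit interval is 1/s up to a bounded error. *)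
Lemma Gamma_near0 : exists K : R, forall s : R, (0 < s < 1)%R ->
  (1 - s <= s * Gamma s <= 1 + K * s)%R.
Proof.
have [K hK] := integral_tail_expR; exists K => s /andP[s0 s1].
have mf (D : set R) : measurable_fun D (fun t : R => (t `^ (s - 1) * expR (- t))%:E).
  apply: measurable_funTS; apply/measurable_EFinP; apply: measurable_funM.
    exact: measurable_powR.
  by apply: measurableT_comp => //; exact: measurable_oppr.
have f0 (D : set R) (t : R) : D t -> 0 <= (t `^ (s - 1) * expR (- t))%:E.
  by rewrite lee_fin mulr_ge0 ?powR_ge0 ?expR_ge0.
have mp (a : R) (D : set R) : measurable_fun D (fun t : R => (t `^ a)%:E).
  by apply: measurable_funTS; apply/measurable_EFinP; exact: measurable_powR.
have mD1 : measurable [set t : R | (0 < t <= 1)%R].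
  exact: (measurable_itv `]0%R, 1%R]).
have mD2 : measurable [set t : R | (1 < t)%R].
  rewrite (_ : [set t | _] = `]1%R, +oo[%classic)//.
  by apply/seteqP; split => t /=; rewrite in_itv/= andbT.
pose J1 := \int[leb]_(t in [set t : R | (0 < t <= 1)%R]) (t `^ (s - 1) * expR (- t))%:E.
pose J2 := \int[leb]_(t in [set t : R | (1 < t)%R]) (t `^ (s - 1) * expR (- t))%:E.
have J : \int[leb]_(t in `]0%R, +oo[) (t `^ (s - 1) * expR (- t))%:E = J1 + J2.
  rewrite -ge0_integral_setU//; last 3 first.
  - exact: mf.
  - exact: f0.
  - apply/disj_setPS => t [] /= /andP[_ h1] h2.
    by move: (lt_le_trans h2 h1); rewrite ltxx.
  congr integral; apply/seteqP; split => t /=; rewrite in_itv/= andbT.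
      by move=> t0; rewrite t0/=; case: leP => _; [left|right].
    by move=> [/andP[->//]|/(lt_trans ltr01)].
have J1le : J1 <= (s^-1)%:E.
  rewrite -integral_unit_powR//; apply: ge0_le_integral => //; [exact: f0|exact: mf|exact: mp|].
  move=> t /= /andP[t0 _]; rewrite lee_fin ler_piMr ?powR_ge0//.
  by rewrite -expR0 ler_expR oppr_le0 ltW.
have J1ge : (s^-1)%:E <= J1 + (1%R)%:E.
  rewrite -integral_unit_powR//.
  apply: (@le_trans _ _ (J1 + \int[leb]_(t in [set t : R | (0 < t <= 1)%R]) (t `^ (s + 1 - 1))%:E)).
    rewrite -ge0_integralD//; last 4 first.
    - exact: f0.
    - exact: mf.
    - by move=> t _; rewrite lee_fin powR_ge0.
    - exact: mp.
    apply: ge0_le_integral => //.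
    - by move=> t _; rewrite lee_fin powR_ge0.
    - exact: mp.
    - apply: emeasurable_funD; [exact: mf|exact: mp].
    move=> t /= /andP[t0 _]; rewrite -EFinD lee_fin.
    have -> : (t `^ (s + 1 - 1) = t `^ (s - 1) * t)%R.
      rewrite -[X in (_ * X)%R]powRr1 ?(ltW t0)// -powRD ?(gt_eqF t0) ?implybT//.
      by congr (_ `^ _)%R; ring.
    rewrite -mulrDr ler_peMr ?powR_ge0//.
    by have := expR_ge1Dx (- t); lra.
  rewrite integral_unit_powR ?addr_gt0// leeD2l// lee_fin invf_le1 ?addr_gt0//.
  by lra.
have J2le : J2 <= K%:E by apply: hK; exact: ltW.
have J10 : 0 <= J1 by apply: integral_ge0; exact: f0.
have J20 : 0 <= J2 by apply: integral_ge0; exact: f0.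
have F1 : J1 \is a fin_num by rewrite ge0_fin_numE// (le_lt_trans J1le)// ltry.
have F2 : J2 \is a fin_num by rewrite ge0_fin_numE// (le_lt_trans J2le)// ltry.
have -> : Gamma s = (fine J1 + fine J2)%R by rewrite /Gamma /Rintegral J fineD.
move: J1le J1ge J2le J10 J20; rewrite -(fineK F1) -(fineK F2).
move: (fine J1) (fine J2) => a b /=; rewrite -EFinD !lee_fin => h1 h2 h3 h4 h5.
have := ler_wpM2l (ltW s0) h1; have := ler_wpM2l (ltW s0) h2.
have := ler_wpM2l (ltW s0) h3; have := mulr_ge0 (ltW s0) h5.
by rewrite mulfV ?gt_eqF//; lra.
Qed.

End gamma.

Lemma cvg_Gamma_factor (R : realType) :
  ((2 - alpha) * Gamma ((2 - alpha) / 2))^-1 @[alpha --> (2 : R)^'-] --> (2^-1 : R).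
Proof.
have [K hK] := Gamma_near0 R.
apply: cvgV => //.
have aff (a b : R) : a + b * ((2 - alpha) / 2) @[alpha --> (2 : R)^'-] --> a.
  rewrite -[X in _ --> X](_ : a + b * ((2 - 2) / 2) = a); last first.
    by rewrite subrr mul0r mulr0 addr0.
  apply: cvg_at_left_filter; apply: cvgD; first exact: cvg_cst.
  apply: cvgM; first exact: cvg_cst.
  apply: cvgM; last exact: cvg_cst.
  by apply: cvgB; [exact: cvg_cst|exact: cvg_id].
apply: (@squeeze_cvgr _ _ _ _ (fun alpha => 2 + (- 2) * ((2 - alpha) / 2))
  (fun alpha => 2 + (2 * K) * ((2 - alpha) / 2))) => //.
near=> alpha.
have a2 : alpha < 2 by near: alpha; exact: nbhs_left_lt.
have a0 : 0 < alpha by near: alpha; exact: nbhs_left_gt.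
have /hK : 0 < (2 - alpha) / 2 < 1 by lra.
have -> : (2 - alpha) * Gamma ((2 - alpha) / 2) =
  2 * ((2 - alpha) / 2 * Gamma ((2 - alpha) / 2)) by field.
by move=> /andP[h1 h2]; apply/andP; split; lra.
Unshelve. all: by end_near. Qed.

(** * Essentially bounded continuous functions are bounded *)

Section bounded.
Variables (R : realType) (n : nat).
Local Notation mu := (lebesgue_row R n).

(** The norm is the maximum norm, whose balls contain open cubes. *)
Lemma lebesgue_row_ball_gt0 (x : 'rV[R]_n) (e : R) : 0 < e ->
  exists2 B, measurable B & (0 < mu B)%E /\ B `<=` ball x e.
Proof.
move=> e0.
exists (box (fun i => `](x ord0 i - e), (x ord0 i + e)[%classic)).
  exact: measurable_box.
split.
  rewrite lebesgue_box//.
  under eq_bigr => i _.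
    rewrite lebesgue_measure_itv/= lte_fin ltrD2l gtrN//.
    rewrite -EFinD (_ : _ - _ = 2 * e); last by ring.
    over.
  by rewrite prodEFin lte_fin prodr_gt0// => i _; rewrite mulr_gt0.
move=> y /= By; split => // i j; rewrite ord1.
have := By j; rewrite /= in_itv/= /ball/= ltr_distlC.
by move=> /andP[h1 h2]; rewrite h1 h2.
Qed.

(** A continuous function exceeding its essential bound at one point exceeds
    it on a ball, and balls are not negligible. *)
Lemma continuous_Lfun_bounded (u : 'rV[R]_n -> R) :
  continuous u -> u \in Lfun mu +oo%E ->
  exists2 M : R, 0 <= M & forall x, `|u x| <= M.
Proof.
move=> cu /sub_Lfun_finLfun/set_mem; rewrite /= /finite_norm unlock /Lnorm.
have -> : (0 < mu [set: 'rV[R]_n])%E.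
  have [B mB [B0 _]] := lebesgue_row_ball_gt0 0 ltr01.
  by apply: (lt_le_trans B0); apply: le_measure; rewrite ?in_setE.
move=> h; have {h} : (ess_sup mu (EFin \o (fun x => `|u x|)%R) < +oo)%E by [].
move=> /ess_supr_bounded[M [A [mA A0 uA]]].
exists (Num.max M 0); first by rewrite le_max lexx orbT.
move=> x; rewrite leNgt; apply/negP; rewrite gt_max => /andP[Mx _].
have ux0 : 0 < `|u x| - M by rewrite subr_gt0.
have /cvgrPdist_lt/(_ _ ux0)/nbhs_ballP[e /= e0 he] := cu x.
have [B mB [B0 Be]] := lebesgue_row_ball_gt0 x e0.
have : (mu B <= mu A)%E.
  apply: le_measure; rewrite ?in_setE//; apply: (subset_trans Be) => z /he h.
  apply: uA => /=; apply/negP; rewrite -ltNge.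
  by have := ler_normD (u x - u z) (u z); rewrite subrK; move: h; rewrite /=; lra.
by rewrite A0 leNgt B0.
Qed.

Lemma measurable_Lfun (u : 'rV[R]_n -> R) :
  u \in Lfun mu +oo%E -> measurable_fun setT u.
Proof. by move=> /sub_Lfun_mfun/set_mem. Qed.

End bounded.

(** * Second differences at a point of second differentiability *)

Section taylor.
Variables (R : realType) (n : nat).
Implicit Types (u : 'rV[R]_n -> R) (x y z : 'rV[R]_n).

(** The index order matches the definition of the Laplacian, so that its trace is
    the Laplacian without any appeal to symmetry of second derivatives. *)
Definition hessian u x : 'M[R]_n :=
  \matrix_(i, j) 'D_(delta_mx ord0 j) (fun z => gradient u z ord0 i) x.

Definition hessian_form u x y : R :=
  \sum_i \sum_j hessian u x i j * (y ord0 i * y ord0 j).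

Lemma laplacianE u x : laplacian u x = \sum_i hessian u x i i.
Proof. by apply: eq_bigr => i _; rewrite mxE. Qed.

Lemma diff_gradient u x y : differentiable u x ->
  'd u x y = \sum_i y ord0 i * gradient u x ord0 i.
Proof.
move=> du; rewrite [in LHS](row_sum_delta y) linear_sum/=.
by apply: eq_bigr => i _; rewrite linearZ/= mxE deriveE.
Qed.

Lemma diff_hessian u x y (i : 'I_n) : differentiable (gradient u) x ->
  ('d (gradient u) x y) ord0 i = \sum_j hessian u x i j * y ord0 j.
Proof.
move=> du; rewrite [in LHS](row_sum_delta y) linear_sum/= summxE.
apply: eq_bigr => j _; rewrite linearZ/= !mxE -deriveE// mulrC.
by rewrite derive_mx ?mxE//; apply: diff_derivable.
Qed.

Lemma hessian_formE u x y : differentiable (gradient u) x ->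
  hessian_form u x y = \sum_i y ord0 i * ('d (gradient u) x y) ord0 i.
Proof.
move=> du; apply: eq_bigr => i _; rewrite diff_hessian// mulr_sumr.
by apply: eq_bigr => j _; ring.
Qed.

Lemma is_derive_line u x y (t : R) : differentiable u (x + t *: y) ->
  is_derive t 1 (fun t => u (x + t *: y)) ('d u (x + t *: y) y).
Proof.
move=> du.
have dl : is_diff t (fun t => x + t *: y) (fun s => s *: y).
  rewrite (_ : (fun s => s *: y) = 0 + (fun s => s *: y)); last by rewrite add0r.
  exact: is_diffD.
have d2 : is_diff (x + t *: y) u ('d u (x + t *: y)) by exact: DiffDef.
have [du' dE] := is_diff_comp dl d2.
apply: DeriveDef; first exact: diff_derivable.
by rewrite deriveE// dE /= scale1r.
Qed.

(** Peano form of the expansion, from differentiability of the gradient at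
    the single point x. The mean value theorem applies to
    t |-> u (x + t y) + u (x - t y) - t^2 Q y
    on the unit interval: its derivative is a combination of increments of the
    gradient between x + t y and x - t y, from which the subtracted term
    removes exactly the linear part. *)
Lemma second_difference_taylor u x : twice_differentiable u x ->
  forall e : R, 0 < e -> exists2 r : R, 0 < r & forall y, `|y| < r ->
  `|u (x + y) + u (x - y) - 2 * u x - hessian_form u x y| <= e * `|y| ^+ 2.
Proof.
move=> [nu dg] e e0.
(* Each of the n coordinates contributes an error 2 eta |y|^2. *)
pose eta := e / (2 * n.+1%:R).
have eta0 : 0 < eta by rewrite divr_gt0 ?mulr_gt0.
have /eqaddoP/(_ _ eta0) := diff_locally dg.
move=> /nbhs_ballP[r1 /= r10 h1].
move: nu => /nbhs_ballP[r2 /= r20 h2].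
exists (Num.min r1 r2); first by rewrite lt_min r10.
move=> y; rewrite lt_min => /andP[yr1 yr2].
have hg z : `|z| < r1 ->
    `|gradient u (x + z) - gradient u x - 'd (gradient u) x z| <= eta * `|z|.
  move=> zr; have := h1 z; rewrite -ball_normE /= sub0r normrN => /(_ zr).
  by rewrite !fctE [z + x]addrC opprD addrA.
have hu (t : R) : `|t| <= 1 -> differentiable u (x + t *: y).
  move=> t1; apply: h2; rewrite -ball_normE /= opprD addNKr normrN normrZ.
  by rewrite (le_lt_trans _ yr2)// ler_piMl.
pose Q := hessian_form u x y.
pose h t := u (x + t *: y) + u (x + t *: (- y)) - t ^+ 2 * Q.
pose dh t := 'd u (x + t *: y) y + 'd u (x + t *: (- y)) (- y) - (2 * t) * Q.
have hN t : t *: (- y) = (- t) *: y by rewrite scalerN scaleNr.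
have h_der (t : R) : `|t| <= 1 -> is_derive t (1 : R) h (dh t).
  move=> t1.
  have d1 := is_derive_line (hu _ t1).
  have d2 : is_derive t (1 : R) (fun t : R => u (x + t *: (- y))) ('d u (x + t *: (- y)) (- y)).
    by apply: is_derive_line; rewrite hN; apply: hu; rewrite normrN.
  have d3 : is_derive t (1 : R) (fun t : R => t ^+ 2 * Q) (2 * t * Q).
    rewrite (_ : (fun t : R => _) = Q *: (@idfun R ^+ 2)); last first.
      by apply/funext => s; rewrite mulrC.
    by apply: is_derive_eq; rewrite expr1 -[_ *: 1]/(_ * _) -[_ *: _]/(_ * _) /=; ring.
  have d12 := is_deriveD d1 d2.
  exact: (is_deriveB d12 d3).
have [c c01 hc] : exists2 c, c \in `]0, 1[ & h 1 - h 0 = dh c * (1 - 0).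
  apply: MVT => // [t|].
    by rewrite in_itv/= => /andP[t0 t1]; apply: h_der; rewrite ger0_norm ltW.
  apply: derivable_within_continuous => t; rewrite in_itv/= => /andP[t0 t1].
  by have [] : is_derive t (1 : R) h (dh t) by apply: h_der; rewrite ger0_norm.
move: c01; rewrite in_itv/= => /andP[c0 c1].
have -> : u (x + y) + u (x - y) - 2 * u x - hessian_form u x y = dh c.
  move: hc; rewrite subr0 mulr1 => <-; rewrite /h !scale1r !scale0r addr0 -/Q.
  ring.
have cn : `|c| <= 1 by rewrite ger0_norm ltW.
have -> : dh c = \sum_i y ord0 i * (gradient u (x + c *: y) ord0 i -
    gradient u (x - c *: y) ord0 i - 2 * c * ('d (gradient u) x y) ord0 i).
  have e1 := diff_gradient y (hu _ cn).
  have hu' : differentiable u (x + c *: (- y)) by rewrite hN; apply: hu; rewrite normrN.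
  have e2 := diff_gradient (- y) hu'.
  apply: (etrans (congr2 (fun a b => a + b - 2 * c * Q) e1 e2)).
  rewrite /Q hessian_formE// mulr_sumr -big_split -sumrB /=.
  by apply: eq_bigr => i _; rewrite hN scaleNr !mxE; ring.
apply: (@le_trans _ _ (\sum_(i < n) 2 * eta * `|y| ^+ 2)); last first.
  rewrite sumr_const card_ord -[leLHS]mulr_natr mulrAC ler_wpM2r ?sqr_ge0//.
  have -> : 2 * eta * n%:R = e * (n%:R / n.+1%:R).
    have : n.+1%:R != 0 :> R by rewrite pnatr_eq0.
    by rewrite /eta; move: (n.+1%:R : R) => m m0; field.
  by rewrite ler_piMr ?(ltW e0)// ler_pdivrMr// mul1r ler_nat.
apply: (le_trans (ler_norm_sum _ _ _)); apply: ler_sum => i _.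
have cy : `|c *: y| = c * `|y| by rewrite normrZ gtr0_norm.
have cyr : `|c *: y| < r1 by rewrite cy (le_lt_trans _ yr1)// ler_piMl// ltW.
have cyr' : `|- (c *: y)| < r1 by rewrite normrN.
pose w := ('d (gradient u) x y) ord0 i.
have eZ : 'd (gradient u) x (c *: y) = c *: 'd (gradient u) x y by exact: linearZ.
have eN : 'd (gradient u) x (- (c *: y)) = - (c *: 'd (gradient u) x y).
  by rewrite -eZ; exact: linearN.
have ha : `|gradient u (x + c *: y) ord0 i - gradient u x ord0 i - c * w| <= eta * (c * `|y|).
  rewrite -cy; apply: le_trans (hg _ cyr); rewrite eZ.
  by have := coord_le_norm (gradient u (x + c *: y) - gradient u x - c *: 'd (gradient u) x y) i; rewrite !mxE.
have hb : `|gradient u (x - c *: y) ord0 i - gradient u x ord0 i - - (c * w)| <= eta * (c * `|y|).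
  rewrite -cy -(normrN (c *: y)); apply: le_trans (hg _ cyr'); rewrite eN.
  by have := coord_le_norm (gradient u (x - c *: y) - gradient u x - - (c *: 'd (gradient u) x y)) i; rewrite !mxE.
rewrite -/w; move: ha hb.
move: (gradient u (x + c *: y) ord0 i) (gradient u (x - c *: y) ord0 i)
  (gradient u x ord0 i) w => a b g w ha hb.
have hy : `|y ord0 i| <= `|y| := coord_le_norm _ _.
rewrite normrM expr2 mulrA [leRHS]mulrC ler_pM//.
rewrite (_ : a - b - 2 * c * w = a - g - c * w - (b - g - - (c * w))); last by ring.
have cy1 : eta * (c * `|y|) <= eta * `|y|.
  by rewrite ler_wpM2l ?(ltW eta0)// ler_piMl// ltW.
rewrite (le_trans (ler_normB _ _))// (le_trans (lerD ha hb))//.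
by rewrite (le_trans (lerD cy1 cy1))// -mulrA mulr_natl.
Qed.
End taylor.

(** * Moments of the unit ball of a p-norm *)

Section moments.
Variables (R : realType) (n : nat) (p : R).
Hypotheses (n_gt0 : (0 < n)%N) (p1 : 1 <= p).
Local Notation mu := (lebesgue_row R n).
Local Notation N := (@lp_norm R n p).
Local Open Scope ereal_scope.

(** The origin is removed because negative powers of the norm take a
    conventional value there. *)
Definition punctured_ball (r : R) : set 'rV[R]_n := [set y | (0 < N y <= r)%R].

Lemma measurable_punctured_ball r : measurable (punctured_ball r).
Proof. exact: (measurable_shell (@measurable_lp_norm R n p)). Qed.

Lemma punctured_ball_coord_map a s r : (forall i, `|a i| = 1)%R ->
  coord_map a s @^-1` punctured_ball r = punctured_ball r.
Proof. by move=> a1; apply/seteqP; split => y /=; rewrite /punctured_ball/= lp_norm_coord_map. Qed.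

Lemma coord_mapZ (r : R) (y : 'rV[R]_n) : coord_map (fun=> r) 1%g y = (r *: y)%R.
Proof. by apply/rowP => i; rewrite !mxE perm1. Qed.

Lemma lebesgue_punctured_ball_lty r : mu (punctured_ball r) < +oo.
Proof.
apply: (le_lt_trans _ (@cube_lty R n (Num.trunc r).+1)).
apply: le_measure; rewrite ?in_setE; first exact: measurable_punctured_ball.
  exact: measurable_box.
move=> y /andP[_ Nr] i /=; rewrite in_itv/= -ler_norml.
by rewrite (le_trans (coord_le_lp_norm p1 y i))// (le_trans Nr)// ltW// truncnS_gt.
Qed.

Section homogeneous.
Variables (G : 'rV[R]_n -> R) (k : nat).
Hypotheses (mG : measurable_fun setT G) (G0 : forall y, (0 <= G y)%R).
Hypothesis GZ : forall (r : R) y, (0 < r)%R -> G (r *: y) = (r ^+ k * G y)%R.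
Hypothesis G1 : forall y, (N y <= 1)%R -> (G y <= 1)%R.

Definition moment : R := fine (\int[mu]_(y in punctured_ball 1) (G y)%:E).

Let mGE (D : set 'rV[R]_n) : measurable_fun D (EFin \o G).
Proof. by apply: measurable_funTS; exact/measurable_EFinP. Qed.

Lemma momentE : \int[mu]_(y in punctured_ball 1) (G y)%:E = moment%:E.
Proof.
rewrite fineK// ge0_fin_numE; last first.
  by apply: integral_ge0 => y _; rewrite lee_fin.
apply: (le_lt_trans _ (lebesgue_punctured_ball_lty 1)).
rewrite -[leRHS]mul1e -integral_cst; last exact: measurable_punctured_ball.
apply: ge0_le_integral => //.
- exact: measurable_punctured_ball.
- by move=> y _; rewrite lee_fin.
- by move=> y /andP[_ y1]; rewrite lee_fin G1.
Qed.

(** A dilation carries the unit ball to the ball of radius r; homogeneity of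
    the density contributes the extra exponent k. *)
Lemma integral_homogeneous_ball (r : R) : (0 < r)%R ->
  \int[mu]_(y in punctured_ball r) (G y)%:E = (moment * r `^ (n + k)%:R)%:E.
Proof.
move=> r0.
have := @ge0_integral_coord_map R n (fun=> r) 1%g (punctured_ball r) (EFin \o G)
  (fun=> lt0r_neq0 r0) (measurable_punctured_ball r) (@mGE _) (fun y _ => G0 y).
rewrite (_ : _ @^-1` _ = punctured_ball 1); last first.
  apply/seteqP; split => y /=; rewrite /punctured_ball/= coord_mapZ lp_normZ//;
  by rewrite gtr0_norm// pmulr_rgt0// -ler_pdivlMl// mulVf ?gt_eqF.
under eq_integral do rewrite coord_mapZ /= GZ// EFinM.
rewrite ge0_integralZl_EFin ?exprn_ge0 ?(ltW r0)//; last 2 first.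
- exact: measurable_punctured_ball.
- by move=> y _; rewrite lee_fin.
rewrite momentE prodr_const card_ord gtr0_norm// => h.
rewrite -[LHS]mul1e -[X in X%:E * _](@mulfV _ (r ^+ n)%R) ?expf_neq0 ?gt_eqF//.
rewrite EFinM -muleA -h.
by rewrite -!EFinM powR_mulrn ?ltW// exprD; congr EFin; ring.
Qed.

Lemma integral_homogeneous_radial (e : R) : (0 < e)%R ->
  \int[mu]_(y in punctured_ball 1) (G y * N y `^ (e - (n + k)%:R))%:E =
  (moment * (n + k)%:R / e)%:E.
Proof.
move=> e0; apply: integral_inner_radial => //.
- exact: measurable_lp_norm.
- by rewrite ltr0n addn_gt0 n_gt0.
- exact: integral_homogeneous_ball.
Qed.

Lemma integral_homogeneous_outer (a : R) : (0 < a)%R ->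
  \int[mu]_(y in [set y | (1 < N y)%R]) (G y * N y `^ (- a - (n + k)%:R))%:E <=
  (moment * expR (n + k)%:R / (1 - expR (- a)))%:E.
Proof.
move=> a0; apply: integral_outer_radial_le => //.
- exact: measurable_lp_norm.
- by rewrite ltr0n addn_gt0 n_gt0.
- exact: integral_homogeneous_ball.
Qed.

End homogeneous.

Definition ball_volume : R := moment (cst 1%R).

Definition second_moment (i : 'I_n) : R := moment (fun y => y ord0 i ^+ 2)%R.

Lemma measurable_coord2 (i : 'I_n) :
  measurable_fun setT (fun y : 'rV[R]_n => y ord0 i ^+ 2)%R.
Proof. by apply: measurable_funX; exact: measurable_row_coord. Qed.

Lemma coord2_le1 (i : 'I_n) (y : 'rV[R]_n) : (N y <= 1)%R -> (y ord0 i ^+ 2 <= 1)%R.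
Proof.
move=> y1; rewrite -real_normK ?num_real// expr_le1// (le_trans _ y1)//.
exact: coord_le_lp_norm.
Qed.

Lemma second_moment_const (i j : 'I_n) : second_moment i = second_moment j.
Proof.
rewrite /second_moment /moment; congr fine.
have one1 (l : 'I_n) : (`|1 : R| = 1)%R by rewrite normr1.
have mf : measurable_fun (punctured_ball 1) (fun y => (y ord0 j ^+ 2)%:E).
  by apply: measurable_funTS; apply/measurable_EFinP; exact: measurable_coord2.
have := integral_coord_isometry (tperm i j) one1 (measurable_punctured_ball 1) mf.
rewrite punctured_ball_coord_map// => <-; apply: eq_integral => y _.
by rewrite mxE mul1r tpermR.
Qed.

(** The unit ball contains the cube with sides [a, 2a], a = 1 / (2n), on which
    the squared coordinate is at least a^2. *)
Lemma second_moment_gt0 (i : 'I_n) : (0 < second_moment i)%R.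
Proof.
pose a : R := ((2 * n%:R)^-1)%R.
have a0 : (0 < a)%R by rewrite invr_gt0 mulr_gt0 ?ltr0n.
pose B := box (fun _ : 'I_n => `[a, (2 * a)%R]%classic : set R).
have mB : measurable B by apply: measurable_box.
have Ba y : B y -> forall j, (a <= y ord0 j <= 2 * a)%R.
  by move=> By j; have := By j; rewrite /= in_itv.
have Bball : B `<=` punctured_ball 1.
  move=> y /Ba By; rewrite /punctured_ball/=; apply/andP; split.
    rewrite (lt_le_trans _ (coord_le_lp_norm p1 y i))// normr_gt0 gt_eqF//.
    by rewrite (lt_le_trans a0)//; have /andP[] := By i.
  rewrite (le_trans (lp_norm_le_norm p1 y))//.
  have y2a : (`|y| <= 2 * a)%R.
    rewrite [leLHS]/Num.Def.normr/= mx_normrE bigmax_le ?mulr_ge0 ?(ltW a0)//.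
    move=> [r j] _ /=; rewrite ord1; have /andP[h1 h2] := By j.
    by rewrite ger0_norm// (le_trans (ltW a0)).
  rewrite (le_trans (ler_wpM2l _ y2a))// /a le_eqVlt; apply/orP; left; apply/eqP.
  by field; rewrite pnatr_eq0 -lt0n.
rewrite -lte_fin -momentE; first last.
- exact: coord2_le1.
- by move=> y; exact: sqr_ge0.
- exact: measurable_coord2.
have mf D : measurable_fun D (fun y : 'rV[R]_n => (y ord0 i ^+ 2)%:E).
  by apply: measurable_funTS; apply/measurable_EFinP; exact: measurable_coord2.
apply: (@lt_le_trans _ _ (\int[mu]_(y in B) (y ord0 i ^+ 2)%:E)); last first.
  apply: ge0_subset_integral => //; first exact: measurable_punctured_ball.
  - by move=> y _; rewrite lee_fin sqr_ge0.
apply: (@lt_le_trans _ _ (\int[mu]_(y in B) (cst (a ^+ 2)%:E y))); last first.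
  apply: ge0_le_integral => //.
  - by move=> y _; rewrite lee_fin sqr_ge0.
  - move=> y /Ba/(_ i)/andP[h1 h2]; rewrite lee_fin lerXn2r// nnegrE ?(ltW a0)//.
    by rewrite (le_trans (ltW a0)).
rewrite integral_cst//; apply: mule_gt0; first by rewrite lte_fin exprn_gt0.
suff muB : mu B = (a ^+ n)%:E by apply: (@lt_le_trans _ _ (mu B)) => //; rewrite muB lte_fin exprn_gt0.
have itvE : lebesgue_measure (`[a, (2 * a)%R]%classic : set R) = a%:E.
  have := lebesgue_measure_itv `[a, (2 * a)%R]; rewrite /= lte_fin ltr_pMl// ltr1n => ->.
  by rewrite -EFinD; congr EFin; ring.
by rewrite /B lebesgue_box// itvE prodEFin prodr_const card_ord.
Qed.

Lemma integral_unit_ball_powR (e : R) : (0 < e)%R ->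
  \int[mu]_(y in punctured_ball 1) (N y `^ (e - n%:R))%:E = (ball_volume * n%:R / e)%:E.
Proof.
move=> e0; have := @integral_homogeneous_radial (cst 1%R) 0 _ _ _ _ e e0.
rewrite addn0 => <- //; last by move=> r y _; rewrite expr0 mul1r.
by under [RHS]eq_integral do rewrite mul1r.
Qed.

Lemma integral_coord2_radial (i : 'I_n) (e : R) : (0 < e)%R ->
  \int[mu]_(y in punctured_ball 1) (y ord0 i ^+ 2 * N y `^ (e - (n + 2)%:R))%:E =
  (second_moment i * (n + 2)%:R / e)%:E.
Proof.
move=> e0; apply: integral_homogeneous_radial => //.
- exact: measurable_coord2.
- by move=> y; exact: sqr_ge0.
- by move=> r y r0; rewrite mxE exprMn.
- exact: coord2_le1.
Qed.

Lemma integral_outer_powR (a : R) : (0 < a)%R ->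
  \int[mu]_(y in [set y | (1 < N y)%R]) (N y `^ (- a - n%:R))%:E <=
  (ball_volume * expR n%:R / (1 - expR (- a)))%:E.
Proof.
move=> a0; have := @integral_homogeneous_outer (cst 1%R) 0 _ _ _ _ a a0.
rewrite addn0; under eq_integral do rewrite mul1r.
by apply => // r y _; rewrite expr0 mul1r.
Qed.

End moments.

(** * A common integrable majorant *)

Section dominating_weight.
Variables (R : realType) (n : nat) (p : R).
Hypotheses (n_gt0 : (0 < n)%N) (p1 : 1 <= p).
Local Notation mu := (lebesgue_row R n).
Local Notation N := (@lp_norm R n p).
Local Notation D1 := (@punctured_ball R n p 1).
Local Notation D2 := [set y : 'rV[R]_n | 1 < N y].
Local Notation D := [set y : 'rV[R]_n | 0 < N y].

Lemma punctured_spaceE : D = D1 `|` D2.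
Proof.
apply/seteqP; split => y; rewrite /punctured_ball/=.
  by move=> ->/=; case: leP; [left|right].
by move=> [/andP[->//]|/(lt_trans ltr01)].
Qed.

Lemma measurable_outer : measurable D2.
Proof.
have -> : D2 = N @^-1` `]1, +oo[%classic.
  by apply/seteqP; split => y /=; rewrite in_itv/= andbT.
by rewrite -[X in measurable X]setTI; exact: (@measurable_lp_norm R n p).
Qed.

Lemma measurable_punctured_space : measurable D.
Proof.
rewrite punctured_spaceE; apply: measurableU; last exact: measurable_outer.
exact: measurable_punctured_ball.
Qed.

Lemma disjoint_ball_outer : [disjoint D1 & D2].
Proof.
apply/disj_setPS => y [] /= /andP[_ h1] h2.
by move: (lt_le_trans h2 h1); rewrite ltxx.
Qed.

Lemma measurable_lp_powR (s : R) (A : set 'rV[R]_n) :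
  measurable_fun A (fun y => N y `^ s).
Proof.
apply: measurable_funTS.
exact: (measurableT_comp (measurable_powR _) (@measurable_lp_norm R n p)).
Qed.

(** The kernel N^(-n-alpha) times min(N^2, 1): second differences of a bounded
    function that is twice differentiable at the base point are at most a
    multiple of min(N^2, 1). *)
Definition weight (alpha : R) (y : 'rV[R]_n) : R :=
  Num.min (N y ^+ 2) 1 * (N y `^ (n%:R + alpha))^-1.

Lemma lp_powR_inv (alpha : R) (k : nat) (y : 'rV[R]_n) : 0 < N y ->
  N y ^+ k * (N y `^ (n%:R + alpha))^-1 = N y `^ (k%:R - alpha - n%:R).
Proof.
move=> N0; rewrite -powRN -powR_mulrn ?ltW// -powRD ?(gt_eqF N0) ?implybT//.
by congr (_ `^ _); ring.
Qed.

Lemma weight_ball alpha y : D1 y -> weight alpha y = N y `^ (2 - alpha - n%:R).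
Proof.
move=> /andP[N0 N1]; rewrite /weight min_l ?lp_powR_inv//.
by rewrite expr_le1// ltW.
Qed.

Lemma weight_outer alpha y : D2 y -> weight alpha y = N y `^ (- alpha - n%:R).
Proof.
move=> /= N1; rewrite /weight min_r; last by rewrite expr_ge1 ?ltW// (lt_trans _ N1).
rewrite -[1](expr0 (N y)) lp_powR_inv; last by rewrite (lt_trans _ N1).
by rewrite sub0r.
Qed.

Lemma weight_ge0 alpha y : 0 <= weight alpha y.
Proof. by rewrite mulr_ge0 ?invr_ge0 ?powR_ge0// le_min sqr_ge0 ler01. Qed.

Lemma measurable_weight alpha (A : set 'rV[R]_n) : measurable_fun A (weight alpha).
Proof.
apply: measurable_funM.
  apply: measurable_minr => //; apply: measurable_funX.
  by apply: measurable_funTS; exact: (@measurable_lp_norm R n p).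
under eq_fun do rewrite -powRN.
exact: measurable_lp_powR.
Qed.

Lemma integrable_weight alpha : 0 < alpha < 2 ->
  mu.-integrable D (EFin \o weight alpha).
Proof.
move=> /andP[a0 a2].
have mW A : measurable_fun A (EFin \o weight alpha).
  by apply/measurable_EFinP; exact: measurable_weight.
apply/integrableP; split => //.
under eq_integral do rewrite /= ger0_norm ?weight_ge0//.
rewrite punctured_spaceE ge0_integral_setU//; last 4 first.
- exact: measurable_punctured_ball.
- exact: measurable_outer.
- by move=> y _; rewrite lee_fin weight_ge0.
- exact: disjoint_ball_outer.
rewrite (eq_integral (fun y => (N y `^ (2 - alpha - n%:R))%:E)); last first.
  by move=> y; rewrite in_setE => yD; rewrite weight_ball.
rewrite integral_unit_ball_powR ?subr_gt0//.
rewrite [X in (_ + X)%E](eq_integral (fun y => (N y `^ (- alpha - n%:R))%:E)); last first.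
  by move=> y; rewrite in_setE => yD; rewrite weight_outer.
rewrite lte_add_pinfty ?ltry//.
by rewrite (le_lt_trans (integral_outer_powR n_gt0 p1 a0))// ltry.
Qed.

End dominating_weight.

(** * Principal values as integrals of second differences *)

Lemma pv_integralZ (R : realType) (n : nat) (c : R) (f : 'rV[R]_n -> R) :
  pv_integrable f -> pv_integrable (fun y => c * f y) /\
  pv_integral (fun y => c * f y) = c * pv_integral f.
Proof.
move=> [intf cvgf].
have mE := @measurable_eucl_exterior R n.
have h : truncated_integral (fun y => c * f y) eps @[eps --> 0^'+] --> c * pv_integral f.
  have : c * truncated_integral f eps @[eps --> 0^'+] --> c * pv_integral f.
    by apply: cvgMr.
  apply: cvg_trans; apply: near_eq_cvg; near=> eps.
  by rewrite /truncated_integral RintegralZl//; apply: intf.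
split; last exact: (cvg_lim _ h).
split; last by apply/cvg_ex; eexists; exact: h.
move=> eps e0.
have := integrableZl (mE eps) c (intf eps e0).
by apply: eq_integrable.
Unshelve. all: by end_near. Qed.

Lemma integrable_reflection (R : realType) (n : nat) (D : set 'rV[R]_n)
    (f : 'rV[R]_n -> R) : measurable D -> (forall y, D (- y) <-> D y) ->
  (lebesgue_row R n).-integrable D (EFin \o f) ->
  (lebesgue_row R n).-integrable D (EFin \o (fun y => f (- y))) /\
  \int[lebesgue_row R n]_(y in D) f (- y) = \int[lebesgue_row R n]_(y in D) f y.
Proof.
move=> mD DN intf.
have one1 (l : 'I_n) : `|-1 : R| = 1 by rewrite normrN1.
have mapN (y : 'rV[R]_n) : coord_map (fun=> -1) 1%g y = - y.
  by rewrite coord_mapZ scaleN1r.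
have DE : coord_map (fun=> -1) 1%g @^-1` D = D.
  by apply/seteqP; split => y /=; rewrite mapN => /DN.
have mf : measurable_fun D (EFin \o f) by case/integrableP : intf.
have maf : measurable_fun D (abse \o (EFin \o f)) by apply: measurableT_comp.
have := integral_coord_isometry 1%g one1 mD mf.
have := integral_coord_isometry 1%g one1 mD maf.
rewrite DE => Ea E; split; last first.
  by rewrite /Rintegral -E; congr fine; apply: eq_integral => y _ /=; rewrite mapN.
apply/integrableP; split.
  rewrite (_ : _ \o _ = (EFin \o f) \o coord_map (fun=> -1) 1%g); last first.
    by apply/funext => y /=; rewrite mapN.
  rewrite -[X in measurable_fun X]DE.
  apply: (measurable_comp mD) => //.
    by move=> _ [y Dy <-].
  by apply: measurable_funTS; exact: measurable_coord_map.
move/integrableP : intf => [_]; rewrite -[X in (X < _)%E -> _]Ea.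
apply: le_lt_trans; rewrite le_eqVlt; apply/orP; left; apply/eqP.
by apply: eq_integral => y _ /=; rewrite mapN.
Qed.

(** Only the even part of the integrand contributes; for an increment against
    an even kernel this replaces first differences by second differences,
    which removes the singularity of order one. *)
Lemma Rintegral_symmetrize (R : realType) (n : nat) (D : set 'rV[R]_n)
    (f : 'rV[R]_n -> R) : measurable D -> (forall y, D (- y) <-> D y) ->
  (lebesgue_row R n).-integrable D (EFin \o f) ->
  \int[lebesgue_row R n]_(y in D) f y =
  \int[lebesgue_row R n]_(y in D) (2^-1 * (f y + f (- y))).
Proof.
move=> mD DN intf; have [intfN eqN] := integrable_reflection mD DN intf.
rewrite (RintegralZl _ mD (integrableD mD intf intfN)) (RintegralD mD intf intfN) eqN.
by set I := Rintegral _ _ _; lra.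
Qed.

Section principal_value.
Variables (R : realType) (n : nat) (p : R).
Hypotheses (n_gt0 : (0 < n)%N) (p1 : 1 <= p).
Local Notation mu := (lebesgue_row R n).
Local Notation N := (@lp_norm R n p).
Local Notation D := [set y : 'rV[R]_n | 0 < N y].
Local Notation outside eps := [set y : 'rV[R]_n | eps < eucl_norm y].

Variables (u : 'rV[R]_n -> R) (x : 'rV[R]_n) (M : R).
Hypotheses (mu_u : measurable_fun setT u) (uM : forall z, `|u z| <= M).
Variable g : 'rV[R]_n -> R.
Hypotheses (mg : measurable_fun setT g) (g01 : forall y, 0 <= g y <= 1).
Hypothesis gN : forall y, g (- y) = g y.

Definition second_difference (y : 'rV[R]_n) : R :=
  u x - (u (x + y) + u (x - y)) / 2.

(** Both kernels of the theorem are, up to a factor depending on alpha alone,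
    of this form: g is the Gaussian factor or the constant 1. *)
Definition base_kernel (alpha : R) (y : 'rV[R]_n) : R :=
  g y * (N y `^ (n%:R + alpha))^-1.

Lemma base_kernel_ge0 alpha y : 0 <= base_kernel alpha y.
Proof. by have /andP[g0 _] := g01 y; rewrite mulr_ge0// invr_ge0 powR_ge0. Qed.

Lemma measurable_base_kernel alpha (A : set 'rV[R]_n) :
  measurable_fun A (base_kernel alpha).
Proof.
apply: measurable_funM; first exact: measurable_funTS.
by under eq_fun do rewrite -powRN; exact: measurable_lp_powR.
Qed.

Lemma measurable_shift (a : R) :
  measurable_fun setT (fun y : 'rV[R]_n => u (x + a *: y)).
Proof.
apply: (measurableT_comp mu_u); apply: measurable_fun_row => i.
under eq_fun do rewrite !mxE.
apply: measurable_funD => //; apply: measurable_funM => //.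
exact: measurable_row_coord.
Qed.

Let mup (A : set 'rV[R]_n) : measurable_fun A (fun y => u (x + y)).
Proof.
apply: measurable_funTS.
by have := measurable_shift 1; under eq_fun do rewrite scale1r.
Qed.

Let mum (A : set 'rV[R]_n) : measurable_fun A (fun y => u (x - y)).
Proof.
apply: measurable_funTS.
by have := measurable_shift (-1); under eq_fun do rewrite scaleN1r.
Qed.

Lemma measurable_second_difference (A : set 'rV[R]_n) :
  measurable_fun A second_difference.
Proof.
apply: measurable_funB => //; apply: measurable_funM => //.
by apply: measurable_funD; [exact: mup|exact: mum].
Qed.

Lemma second_difference_le y : `|second_difference y| <= 2 * M.
Proof.
rewrite /second_difference; have := uM x; have := uM (x + y); have := uM (x - y).
by rewrite !ler_norml => /andP[? ?] /andP[? ?] /andP[? ?]; apply/andP; split; lra.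
Qed.

Let M0 : 0 <= M. Proof. exact: le_trans (normr_ge0 _) (uM x). Qed.

Let mE := @measurable_eucl_exterior R n.

Let le12 : 1 <= 2 :> R. Proof. by rewrite ler1n. Qed.

Lemma outside_lp_norm eps y : 0 < eps -> outside eps y -> eps / n%:R < N y.
Proof.
move=> e0 /= ey; rewrite ltr_pdivrMr ?ltr0n// mulrC.
apply: (lt_le_trans ey); rewrite eucl_normE (le_trans (lp_norm_le_norm le12 y))//.
by rewrite ler_wpM2l// norm_le_lp_norm.
Qed.

Lemma outside_sub eps : 0 < eps -> outside eps `<=` D.
Proof.
move=> e0 y /(outside_lp_norm e0); apply: lt_trans.
by rewrite divr_gt0 ?ltr0n.
Qed.

Lemma integrable_increment alpha eps : 0 < alpha < 2 -> 0 < eps ->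
  mu.-integrable (outside eps) (EFin \o increment (base_kernel alpha) u x).
Proof.
move=> ha e0.
pose m := Num.min ((eps / n%:R) ^+ 2) 1.
have m0 : 0 < m by rewrite lt_min ltr01 exprn_gt0// divr_gt0 ?ltr0n.
have iW : mu.-integrable (outside eps) (EFin \o (fun y => (2 * M / m) * weight p alpha y)).
  have := integrableS (@measurable_punctured_space R n p) (mE eps)
    (outside_sub e0) (integrable_weight n_gt0 p1 ha).
  by move=> /(integrableZl (mE eps) (2 * M / m)); apply: eq_integrable => //; exact: mE.
apply: (le_integrable (mE eps) _ _ iW).
  apply/measurable_EFinP; apply: measurable_funM; last exact: measurable_base_kernel.
  by apply: measurable_funB => //; exact: mup.
move=> y ye; rewrite lee_fin /increment normrM (ger0_norm (base_kernel_ge0 alpha y)) [leRHS]ger0_norm; last first.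
  by rewrite mulr_ge0 ?weight_ge0// divr_ge0 ?mulr_ge0 ?(ltW m0).
apply: (@le_trans _ _ (2 * M * (N y `^ (n%:R + alpha))^-1)).
  apply: ler_pM => //; rewrite ?base_kernel_ge0//.
    by rewrite (le_trans (ler_normB _ _))// mulr_natl mulr2n lerD.
  by have /andP[_ g1] := g01 y; rewrite ler_piMl ?invr_ge0 ?powR_ge0.
rewrite /weight mulrA ler_wpM2r ?invr_ge0 ?powR_ge0// -mulrA ler_peMr ?mulr_ge0//.
rewrite mulrC ler_pdivlMr// mul1r /m le_min2//.
have := outside_lp_norm e0 ye => /ltW h.
by rewrite lerXn2r ?nnegrE ?lp_norm_ge0// divr_ge0 ?(ltW e0).
Qed.

Lemma truncated_integral_second_difference alpha eps : 0 < alpha < 2 -> 0 < eps ->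
  truncated_integral (increment (base_kernel alpha) u x) eps =
  \int[mu]_(y in outside eps) (second_difference y * base_kernel alpha y).
Proof.
move=> ha e0; set f := increment _ _ _.
have intf := integrable_increment ha e0.
have outN y : outside eps (- y) <-> outside eps y.
  by rewrite /= !eucl_normE lp_normN.
have kN y : base_kernel alpha (- y) = base_kernel alpha y.
  by rewrite /base_kernel gN lp_normN.
rewrite /truncated_integral (Rintegral_symmetrize (mE eps) outN intf).
apply: eq_Rintegral => y _; rewrite /f /increment kN /second_difference.
by move: (u x) (u (x + y)) (u (x - y)) (base_kernel alpha y) => a b c k; lra.
Qed.

Variable C : R.
Hypothesis SC : forall y, `|second_difference y| <= C * Num.min (N y ^+ 2) 1.

Let SB alpha (y : 'rV[R]_n) := second_difference y * base_kernel alpha y.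

Let SBW alpha y : `|SB alpha y| <= C * weight p alpha y.
Proof.
rewrite /SB normrM (ger0_norm (base_kernel_ge0 alpha y)) /weight [leRHS]mulrA.
apply: ler_pM => //; [exact: base_kernel_ge0|rewrite /base_kernel].
by have /andP[_ g1] := g01 y; rewrite ler_piMl ?invr_ge0 ?powR_ge0.
Qed.

Let mSB alpha (A : set 'rV[R]_n) : measurable_fun A (EFin \o SB alpha).
Proof.
apply/measurable_EFinP; apply: measurable_funM; first exact: measurable_second_difference.
exact: measurable_base_kernel.
Qed.

Let mD := @measurable_punctured_space R n p.

Let iCW alpha : 0 < alpha < 2 ->
  mu.-integrable D (fun y => C%:E * (weight p alpha y)%:E)%E.
Proof. by move=> ha; apply: (integrableZl mD); exact: integrable_weight. Qed.

Lemma integrable_second_difference alpha : 0 < alpha < 2 ->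
  mu.-integrable D (EFin \o SB alpha).
Proof.
move=> ha; apply: (le_integrable mD _ _ (iCW ha)); first exact: (@mSB _ _).
by move=> y _; rewrite -EFinM /= lee_fin (le_trans (SBW alpha y))// ler_norm.
Qed.

(** Dominated convergence along sequences of radii. The truncation is by the
    Euclidean norm whatever p is; a point other than the origin
    lies outside all but finitely many of the removed balls. *)
Lemma cvg_truncated_integral alpha : 0 < alpha < 2 ->
  truncated_integral (increment (base_kernel alpha) u x) eps @[eps --> 0^'+] -->
  \int[mu]_(y in D) SB alpha y.
Proof.
move=> ha; apply/cvg_at_rightP => v [v0 v_cvg].
pose F k := (EFin \o SB alpha) \_ (outside (v k)).
have FE k : truncated_integral (increment (base_kernel alpha) u x) (v k) =
    fine (\int[mu]_(y in D) F k y)%E.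
  rewrite truncated_integral_second_difference// /Rintegral /F -integral_mkcondr.
  congr (fine (integral _ _ _)); rewrite setIidr//; exact: outside_sub.
rewrite (_ : (fun k => _) = fine \o (fun k => \int[mu]_(y in D) F k y)%E); last first.
  by apply/funext => k; exact: FE.
apply: fine_cvg; rewrite fineK; last first.
  exact: (integrable_fin_num mD (integrable_second_difference ha)).
have mF k : measurable_fun D (F k).
  apply/measurable_restrict => //; exact: mE.
have FSB : {ae mu, forall y, D y -> F ^~ y @ \oo --> (SB alpha y)%:E}.
  apply: aeW => y Dy; apply: cvg_near_cst.
  have ey : 0 < eucl_norm y by rewrite eucl_normE lp_norm_gt0 // -(lp_norm_gt0 p1).
  have : \forall k \near \oo, v k < eucl_norm y by exact: (cvgr_lt 0).
  by apply: filterS => k vk; rewrite /F patchE mem_set.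
have FW : {ae mu, forall y k, D y -> (`|F k y| <= C%:E * (weight p alpha y)%:E)%E}.
  apply: aeW => y k Dy; rewrite /F patchE; case: ifP => _.
    by rewrite -EFinM /= lee_fin.
  rewrite abse0 -EFinM lee_fin; exact: le_trans (normr_ge0 _) (SBW alpha y).
by have [_ _] := dominated_convergence mD mF (@mSB alpha D) FSB (iCW ha) FW.
Qed.

Lemma pv_integral_second_difference alpha : 0 < alpha < 2 ->
  pv_integrable (increment (base_kernel alpha) u x) /\
  pv_integral (increment (base_kernel alpha) u x) =
  \int[mu]_(y in D) (second_difference y * base_kernel alpha y).
Proof.
move=> ha; have h := cvg_truncated_integral ha; split; last exact: (cvg_lim _ h).
split; last by apply/cvg_ex; eexists; exact: h.
by move=> eps e0; exact: integrable_increment.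
Qed.

End principal_value.

(** * Integrals of quadratic forms against the kernel *)

Section Rintegral_complements.
Context d (T : measurableType d) (R : realType) (mu : {measure set T -> \bar R}).
Variables (D : set T) (mD : measurable D).

Lemma normr_Rintegral_le (f h : T -> R) : measurable_fun D f ->
  mu.-integrable D (EFin \o h) -> (forall x, D x -> `|f x| <= h x) ->
  `|\int[mu]_(x in D) f x| <= \int[mu]_(x in D) h x.
Proof.
move=> mf ih fh.
have intf : mu.-integrable D (EFin \o f).
  apply: (le_integrable mD _ _ ih); first exact/measurable_EFinP.
  by move=> x Dx; rewrite lee_fin (le_trans (fh x Dx))// ler_norm.
apply: (le_trans (le_normr_Rintegral mD intf)); apply: le_Rintegral => //.
exact: (integrable_norm intf).
Qed.

Lemma Rintegral_sum (I : Type) (s : seq I) (h : I -> T -> R) :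
  (forall i, mu.-integrable D (EFin \o h i)) ->
  \int[mu]_(x in D) (\sum_(i <- s) h i x) = \sum_(i <- s) \int[mu]_(x in D) h i x.
Proof.
move=> ih; elim: s => [|i s IH].
  by under eq_Rintegral do rewrite big_nil; rewrite big_nil Rintegral_cst// mul0r.
under eq_Rintegral do rewrite big_cons.
rewrite big_cons -IH RintegralD//.
have := integrable_sum mD s (P := xpredT) (fun i _ => ih i).
by apply: eq_integrable => // x _ /=; rewrite sumEFin.
Qed.

End Rintegral_complements.

Lemma Rintegral_coord_odd (R : realType) (n : nat) (D : set 'rV[R]_n)
    (f : 'rV[R]_n -> R) (a : 'I_n -> R) : measurable D -> (forall i, `|a i| = 1) ->
  coord_map a 1%g @^-1` D = D -> (forall y, f (coord_map a 1%g y) = - f y) ->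
  (lebesgue_row R n).-integrable D (EFin \o f) ->
  \int[lebesgue_row R n]_(y in D) f y = 0.
Proof.
move=> mD a1 DE fN intf.
have mf : measurable_fun D (EFin \o f) by case/integrableP : intf.
have := integral_coord_isometry 1%g a1 mD mf; rewrite DE => E.
have : \int[lebesgue_row R n]_(y in D) (-1 * f y) = \int[lebesgue_row R n]_(y in D) f y.
  rewrite [RHS]/Rintegral -E /Rintegral; congr fine.
  by apply: eq_integral => y _ /=; rewrite fN mulN1r.
rewrite RintegralZl// mulN1r.
by set I := Rintegral _ _ _; lra.
Qed.

Section radial_bounds.
Variables (R : realType) (n : nat) (p : R).
Hypotheses (n_gt0 : (0 < n)%N) (p1 : 1 <= p).
Local Notation mu := (lebesgue_row R n).
Local Notation N := (@lp_norm R n p).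
Local Notation D1 := (@punctured_ball R n p 1).
Local Notation D2 := [set y : 'rV[R]_n | 1 < N y].
Local Notation D := [set y : 'rV[R]_n | 0 < N y].
Local Notation vol := (@ball_volume R n p).

Let mD1 : measurable D1. Proof. exact: measurable_punctured_ball. Qed.
Let mD2 : measurable D2. Proof. exact: measurable_outer. Qed.

Lemma integrable_ball_powR (s : R) : 0 < s ->
  mu.-integrable D1 (EFin \o (fun y => N y `^ (s - n%:R))).
Proof.
move=> s0; apply/integrableP; split.
  by apply/measurable_EFinP; exact: measurable_lp_powR.
under eq_integral do rewrite /= ger0_norm ?powR_ge0//.
by rewrite integral_unit_ball_powR// ltry.
Qed.

Lemma Rintegral_ball_powR (s : R) : 0 < s ->
  \int[mu]_(y in D1) (N y `^ (s - n%:R)) = vol * n%:R / s.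
Proof. by move=> s0; rewrite /Rintegral integral_unit_ball_powR. Qed.

Lemma integrable_outer_powR (s : R) : 0 < s ->
  mu.-integrable D2 (EFin \o (fun y => N y `^ (- s - n%:R))).
Proof.
move=> s0; apply/integrableP; split.
  by apply/measurable_EFinP; exact: measurable_lp_powR.
under eq_integral do rewrite /= ger0_norm ?powR_ge0//.
by rewrite (le_lt_trans (integral_outer_powR n_gt0 p1 s0))// ltry.
Qed.

Lemma Rintegral_outer_powR_le (s : R) : 0 < s ->
  \int[mu]_(y in D2) (N y `^ (- s - n%:R)) <= vol * expR n%:R / (1 - expR (- s)).
Proof.
move=> s0; rewrite -lee_fin /Rintegral fineK ?integral_outer_powR//.
exact: (integrable_fin_num mD2 (integrable_outer_powR s0)).
Qed.

(** Off the diagonal, the change of sign of one coordinate preserves the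
    ball and the norm, and it negates the integrand. *)
Lemma Rintegral_coord_mul (i j : 'I_n) (alpha : R) : 0 < alpha < 2 ->
  mu.-integrable D1 (EFin \o (fun y : 'rV[R]_n => y ord0 i * y ord0 j * (N y `^ (n%:R + alpha))^-1)) /\
  \int[mu]_(y in D1) (y ord0 i * y ord0 j * (N y `^ (n%:R + alpha))^-1) =
  if i == j then second_moment p i * (n + 2)%:R / (2 - alpha) else 0.
Proof.
move=> /andP[a0 a2].
have int : mu.-integrable D1 (EFin \o (fun y : 'rV[R]_n =>
    y ord0 i * y ord0 j * (N y `^ (n%:R + alpha))^-1)).
  have s0 : 0 < 2 - alpha by rewrite subr_gt0.
  apply: (le_integrable mD1 _ _ (integrable_ball_powR s0)).
    apply/measurable_EFinP; apply: measurable_funM.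
      by apply: measurable_funTS; apply: measurable_funM; exact: measurable_row_coord.
    by under eq_fun do rewrite -powRN; exact: measurable_lp_powR.
  move=> y /andP[N0 _]; rewrite lee_fin [leRHS]ger0_norm ?powR_ge0//.
  rewrite -(lp_powR_inv alpha 2 N0) !normrM expr2 (ger0_norm (x := _^-1)) ?invr_ge0 ?powR_ge0//.
  by rewrite ler_wpM2r ?invr_ge0 ?powR_ge0// ler_pM// coord_le_lp_norm.
split=> //; have [<-|ij] := eqVneq i j.
  rewrite /Rintegral -[RHS]/(fine (_%:E)) -integral_coord2_radial ?subr_gt0//.
  congr fine; apply: eq_integral => y _; rewrite -powRN expr2; congr (_ * _ `^ _)%:E.
  by rewrite natrD; ring.
pose a (l : 'I_n) : R := if l == i then -1 else 1.
have a1 l : `|a l| = 1 by rewrite /a; case: ifP; rewrite ?normrN1 ?normr1.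
have aD : coord_map a 1%g @^-1` D1 = D1 by exact: punctured_ball_coord_map.
refine (Rintegral_coord_odd mD1 a1 aD _ int) => y.
have ay l : coord_map a 1%g y ord0 l = a l * y ord0 l by rewrite mxE perm1.
have -> : N (coord_map a 1%g y) = N y by exact: lp_norm_coord_map.
by rewrite (ay i) (ay j) /a eqxx (eq_sym j) (negbTE ij) mul1r mulN1r !mulNr.
Qed.

Lemma Rintegral_hessian_form (u : 'rV[R]_n -> R) x (alpha : R) (i0 : 'I_n) : 0 < alpha < 2 ->
  mu.-integrable D1 (EFin \o (fun y => hessian_form u x y * (N y `^ (n%:R + alpha))^-1)) /\
  \int[mu]_(y in D1) (hessian_form u x y * (N y `^ (n%:R + alpha))^-1) =
  laplacian u x * (second_moment p i0 * (n + 2)%:R / (2 - alpha)).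
Proof.
move=> ha.
pose h i j (y : 'rV[R]_n) := hessian u x i j *
  (y ord0 i * y ord0 j * (N y `^ (n%:R + alpha))^-1).
have ih i j : mu.-integrable D1 (EFin \o h i j).
  by have [ii _] := Rintegral_coord_mul i j ha; exact: (integrableZl mD1 _ ii).
have ihs i : mu.-integrable D1 (EFin \o (fun y => \sum_j h i j y)).
  have := integrable_sum mD1 (index_enum 'I_n) (P := xpredT) (fun j _ => ih i j).
  by apply: eq_integrable => // y _ /=; rewrite sumEFin.
have QE y : hessian_form u x y * (N y `^ (n%:R + alpha))^-1 = \sum_i \sum_j h i j y.
  rewrite mulr_suml; apply: eq_bigr => i _; rewrite mulr_suml; apply: eq_bigr => j _.
  by rewrite /h !mulrA.
split.
  have := integrable_sum mD1 (index_enum 'I_n) (P := xpredT) (fun j _ => ihs j).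
  by apply: eq_integrable => // y _ /=; rewrite sumEFin QE.
under eq_Rintegral do rewrite QE.
rewrite Rintegral_sum// laplacianE mulr_suml; apply: eq_bigr => i _.
rewrite Rintegral_sum// (bigD1 i)//= big1 ?addr0 => [|j ji].
  have [ii E] := Rintegral_coord_mul i i ha.
  by rewrite RintegralZl// E eqxx (second_moment_const p i i0).
have [ii E] := Rintegral_coord_mul i j ha.
by rewrite RintegralZl// E eq_sym (negbTE ji) mulr0.
Qed.

End radial_bounds.

(** * The limit of the second difference integrals *)

Section second_order_limit.
Variables (R : realType) (n : nat) (p : R).
Hypotheses (n_gt0 : (0 < n)%N) (p1 : 1 <= p).
Local Notation mu := (lebesgue_row R n).
Local Notation N := (@lp_norm R n p).
Local Notation D1 := (@punctured_ball R n p 1).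
Local Notation D2 := [set y : 'rV[R]_n | 1 < N y].
Local Notation D := [set y : 'rV[R]_n | 0 < N y].
Local Notation vol := (@ball_volume R n p).

Variables (u : 'rV[R]_n -> R) (x : 'rV[R]_n) (M : R).
Hypotheses (mu_u : measurable_fun setT u) (uM : forall z, `|u z| <= M).
Hypothesis (u2 : twice_differentiable u x).
Variable g : 'rV[R]_n -> R.
Hypotheses (mg : measurable_fun setT g) (g01 : forall y, 0 <= g y <= 1).
Hypothesis g_near0 : forall y, 1 - g y <= N y ^+ 2.

Local Notation S := (second_difference u x).
Local Notation Q := (hessian_form u x).

Let M0 : 0 <= M. Proof. exact: le_trans (normr_ge0 _) (uM x). Qed.

Lemma second_difference_taylor_lp (e : R) : 0 < e ->
  exists2 r : R, 0 < r & forall y, N y < r -> `|S y + Q y / 2| <= e * N y ^+ 2.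
Proof.
move=> e0; have [r r0 h] := second_difference_taylor u2 e0.
exists r => // y yr.
have := h y (le_lt_trans (norm_le_lp_norm p1 y) yr).
rewrite (_ : u (x + y) + _ - _ - _ = - (2 * (S y + Q y / 2))); last first.
  by rewrite /second_difference; field.
rewrite normrN normrM (ger0_norm (ler0n _ _)) => h2.
have : e * `|y| ^+ 2 <= e * N y ^+ 2.
  by rewrite ler_wpM2l ?(ltW e0)// lerXn2r ?nnegrE ?lp_norm_ge0// norm_le_lp_norm.
have := normr_ge0 (S y + Q y / 2).
lra.
Qed.

Definition hessian_bound : R := \sum_i \sum_j `|hessian u x i j|.

Let H0 : 0 <= hessian_bound.
Proof. by apply: sumr_ge0 => i _; apply: sumr_ge0. Qed.

Lemma hessian_form_le y : `|Q y| <= hessian_bound * N y ^+ 2.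
Proof.
rewrite mulr_suml; apply: (le_trans (ler_norm_sum _ _ _)); apply: ler_sum => i _.
rewrite mulr_suml; apply: (le_trans (ler_norm_sum _ _ _)); apply: ler_sum => j _.
by rewrite !normrM ler_wpM2l// expr2 ler_pM// coord_le_lp_norm.
Qed.

Lemma second_difference_quadratic :
  exists C : R, forall y, `|S y| <= C * Num.min (N y ^+ 2) 1.
Proof.
have [r r0 h] := second_difference_taylor_lp ltr01.
have S2M y : `|S y| <= 2 * M by exact: second_difference_le.
exists (1 + hessian_bound + 2 * M / r ^+ 2 + 2 * M) => y.
have Mr : 0 <= 2 * M / r ^+ 2 by rewrite divr_ge0 ?mulr_ge0 ?exprn_ge0 ?(ltW r0).
case: (leP (N y ^+ 2) 1) => N1; last first.
  have H1 := H0.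
  by rewrite mulr1 (le_trans (S2M y))//; lra.
have N0 := sqr_ge0 (N y).
case: (ltP (N y) r) => yr.
  have := h y yr; have := hessian_form_le y; rewrite mul1r.
  have := mulr_ge0 H0 N0; have := mulr_ge0 Mr N0; have := mulr_ge0 M0 N0.
  rewrite !mulrDl !ler_norml.
  move: (S y) (Q y) (2 * M / r ^+ 2 * N y ^+ 2) (hessian_bound * N y ^+ 2) => s q k H.
  by move=> h5 h6 h7 /andP[h1 h2] /andP[h3 h4]; apply/andP; split; lra.
apply: (@le_trans _ _ (2 * M / r ^+ 2 * N y ^+ 2)).
  rewrite (le_trans (S2M y))// -mulrA ler_peMr ?mulr_ge0//.
  rewrite mulrC ler_pdivlMr ?exprn_gt0// mul1r lerXn2r ?nnegrE ?(ltW r0) ?lp_norm_ge0//.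
have H1 := H0; have M1 := M0.
by rewrite ler_wpM2r//; lra.
Qed.

(** The error in the expansion is e N^2 for small N; away from 0 it is
    bounded, and so is absorbed by a cubic term. The cubic term is what makes
    a single estimate on the whole unit ball possible: its integral
    against the kernel stays bounded as alpha tends to 2, and so it
    disappears after multiplication by 2 - alpha. *)
Lemma second_difference_cubic (e : R) : 0 < e ->
  exists2 C : R, 0 <= C & forall y, N y <= 1 ->
  `|S y * g y + Q y / 2| <= e * N y ^+ 2 + C * N y ^+ 3.
Proof.
move=> e0; have [r r0 h] := second_difference_taylor_lp e0.
have Mr : 0 <= 2 * M / r ^+ 3 by rewrite divr_ge0 ?mulr_ge0 ?exprn_ge0 ?(ltW r0).
(* The first two terms absorb the region N >= r, where N^3 >= r N^2; the last
   one absorbs the defect 1 - g <= N^2 where N < r. *)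
exists (2 * M / r ^+ 3 + hessian_bound / r + hessian_bound).
  by rewrite !addr_ge0// divr_ge0// ltW.
move=> y N1; have N0 := lp_norm_ge0 p y.
have /andP[g0 g1] := g01 y.
have N2 := sqr_ge0 (N y); have N3 : 0 <= N y ^+ 3 by rewrite exprn_ge0.
have Qle := hessian_form_le y.
have Hr : 0 <= hessian_bound / r by rewrite divr_ge0// ltW.
case: (ltP (N y) r) => yr.
  rewrite (_ : S y * g y + Q y / 2 = (S y + Q y / 2) * g y + Q y * ((1 - g y) / 2)); last by ring.
  rewrite (le_trans (ler_normD _ _))// lerD//.
    rewrite normrM (ger0_norm g0) (le_trans _ (h y yr))// ler_piMr//.
  rewrite normrM (ger0_norm (x := _ / 2)); last by rewrite divr_ge0// subr_ge0.
  apply: (@le_trans _ _ (hessian_bound * N y ^+ 3)).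
    apply: (@le_trans _ _ (hessian_bound * N y ^+ 2 * N y)).
      apply: ler_pM => //; first by rewrite divr_ge0// subr_ge0.
      apply: (@le_trans _ _ (N y ^+ 2)); last by rewrite expr2 ler_piMl.
      by have := g_near0 y; lra.
    by rewrite -mulrA -exprSr.
  have H1 := H0.
  by rewrite ler_wpM2r//; lra.
have S2M : `|S y| <= 2 * M by exact: second_difference_le.
rewrite (le_trans (ler_normD _ _))//.
have h1 : `|S y * g y| <= 2 * M / r ^+ 3 * N y ^+ 3.
  rewrite normrM (ger0_norm g0) (@le_trans _ _ (2 * M))//.
    by rewrite (le_trans _ S2M)// ler_piMr.
  rewrite -mulrA ler_peMr ?mulr_ge0// mulrC ler_pdivlMr ?exprn_gt0// mul1r.
  by rewrite lerXn2r ?nnegrE ?(ltW r0).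
have h2 : `|Q y / 2| <= hessian_bound / r * N y ^+ 3.
  rewrite normrM (@le_trans _ _ `|Q y|)//.
    by rewrite ler_piMr// ger0_norm ?invr_ge0// invf_le1// ler1n.
  rewrite (le_trans Qle)// -mulrA ler_wpM2l// mulrC ler_pdivlMr//.
  by rewrite [leRHS]exprSr ler_wpM2l.
have := mulr_ge0 H0 N3; have := mulr_ge0 (ltW e0) N2; lra.
Qed.

Let mD1 : measurable D1. Proof. exact: measurable_punctured_ball. Qed.
Let mD2 : measurable D2. Proof. exact: measurable_outer. Qed.
Let mD : measurable D. Proof. exact: measurable_punctured_space. Qed.

Let SB alpha (y : 'rV[R]_n) := S y * base_kernel p g alpha y.

Let mSB alpha (A : set 'rV[R]_n) : measurable_fun A (SB alpha).
Proof.
apply: measurable_funM; first exact: measurable_second_difference.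
exact: measurable_base_kernel.
Qed.

(** Uniform in alpha: the part of the integral outside the unit ball
    disappears after multiplication by 2 - alpha. *)
Lemma integral_outer_le (alpha : R) : 1 <= alpha < 2 ->
  `|\int[mu]_(y in D2) SB alpha y| <= 2 * M * (vol * expR n%:R / (1 - expR (- 1))).
Proof.
move=> /andP[a1 a2]; have a0 : 0 < alpha by exact: lt_le_trans a1.
have i2 := integrable_outer_powR n_gt0 p1 a0.
apply: (@le_trans _ _ (\int[mu]_(y in D2) (2 * M * N y `^ (- alpha - n%:R)))).
  apply: normr_Rintegral_le => //; first exact: (integrableZl mD2 (2 * M) i2).
  move=> y /= N1; have N0 : 0 < N y by exact: lt_trans N1.
  rewrite normrM (ger0_norm (base_kernel_ge0 p g01 alpha y)); apply: ler_pM => //.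
  - exact: base_kernel_ge0.
  - exact: second_difference_le.
  have := lp_powR_inv alpha 0 N0; rewrite expr0 mul1r sub0r => <-.
  by have /andP[_ g1] := g01 y; rewrite ler_piMl ?invr_ge0 ?powR_ge0.
rewrite (RintegralZl _ mD2 i2) ler_wpM2l ?mulr_ge0//.
apply: (le_trans (Rintegral_outer_powR_le n_gt0 p1 a0)).
have e1 : 0 < 1 - expR (- 1) :> R by rewrite subr_gt0 -expR0 ltr_expR oppr_lt0.
have ea : 1 - expR (- 1) <= 1 - expR (- alpha) by rewrite lerD2l lerN2 ler_expR lerN2.
rewrite ler_wpM2l//; last by rewrite lef_pV2 ?posrE// (lt_le_trans e1).
by rewrite mulr_ge0 ?expR_ge0// fine_ge0// integral_ge0// => y _; rewrite lee_fin.
Qed.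

Lemma integral_ball_le (i0 : 'I_n) (e : R) : 0 < e -> exists2 C : R, 0 <= C &
  forall alpha : R, 1 <= alpha < 2 ->
  `|(2 - alpha) * (\int[mu]_(y in D1) SB alpha y) +
    laplacian u x * (second_moment p i0 * (n + 2)%:R) / 2| <=
  (e + C * (2 - alpha)) * (vol * n%:R).
Proof.
move=> e0; have [C C0 hC] := second_difference_cubic e0.
exists C => // alpha /andP[a1 a2].
have a0 : 0 < alpha by exact: lt_le_trans a1.
have ha : 0 < alpha < 2 by rewrite a0.
have t0 : 0 < 2 - alpha by rewrite subr_gt0.
have t1 : 0 < 3 - alpha by rewrite subr_gt0 (lt_trans a2)// ltr_nat.
have [iQ EQ] := Rintegral_hessian_form n_gt0 p1 u x i0 ha.
have [K hK] := second_difference_quadratic.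
have iSB : mu.-integrable D1 (EFin \o SB alpha).
  apply: (integrableS mD mD1) (integrable_second_difference n_gt0 p1 mu_u mg g01 hK ha).
  by move=> y /andP[].
pose F y := SB alpha y + 2^-1 * (Q y * (N y `^ (n%:R + alpha))^-1).
have iQ2 : mu.-integrable D1 (EFin \o (fun y => 2^-1 * (Q y * (N y `^ (n%:R + alpha))^-1))).
  exact: (integrableZl mD1 2^-1 iQ).
have FE : \int[mu]_(y in D1) F y = (\int[mu]_(y in D1) SB alpha y) +
    2^-1 * (laplacian u x * (second_moment p i0 * (n + 2)%:R / (2 - alpha))).
  by rewrite (RintegralD mD1 iSB iQ2) (RintegralZl _ mD1 iQ) EQ.
pose h2 y := e * N y `^ (2 - alpha - n%:R).
pose h3 y := C * N y `^ (3 - alpha - n%:R).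
have i2 := integrable_ball_powR n_gt0 p1 t0.
have i3 := integrable_ball_powR n_gt0 p1 t1.
have ih2 : mu.-integrable D1 (EFin \o h2) by exact: (integrableZl mD1 e i2).
have ih3 : mu.-integrable D1 (EFin \o h3) by exact: (integrableZl mD1 C i3).
have Fle : `|\int[mu]_(y in D1) F y| <= \int[mu]_(y in D1) (h2 y + h3 y).
  apply: normr_Rintegral_le => //.
  - by apply/measurable_EFinP; case/integrableP : (integrableD mD1 iSB iQ2).
  - exact: (integrableD mD1 ih2 ih3).
  move=> y /andP[N0 N1].
  rewrite /h2 /h3 -(lp_powR_inv alpha 2 N0) -(lp_powR_inv alpha 3 N0).
  rewrite [X in _ <= X + _]mulrA [X in _ <= _ + X]mulrA -mulrDl.
  have -> : F y = (S y * g y + Q y / 2) * (N y `^ (n%:R + alpha))^-1.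
    by rewrite /F /SB /base_kernel; move: (_^-1) => k; lra.
  have k0 : 0 <= (N y `^ (n%:R + alpha))^-1 by rewrite invr_ge0 powR_ge0.
  by rewrite normrM (ger0_norm k0); apply: ler_wpM2r => //; exact: hC.
move: Fle; rewrite FE (RintegralD mD1 ih2 ih3) (RintegralZl _ mD1 i2) (RintegralZl _ mD1 i3).
rewrite !Rintegral_ball_powR//.
have v0 : 0 <= vol * n%:R.
  rewrite mulr_ge0// fine_ge0// integral_ge0// => y _; rewrite lee_fin//.
move: (\int[mu]_(y in D1) SB alpha y) (vol * n%:R) v0 => I V V0.
set L := laplacian u x; set m := second_moment p i0 * (n + 2)%:R => h.
rewrite (_ : (2 - alpha) * I + L * m / 2 = (2 - alpha) * (I + 2^-1 * (L * (m / (2 - alpha))))).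
  rewrite normrM (gtr0_norm t0) -ler_pdivlMl//; apply: (le_trans h).
  rewrite mulrDl mulrDr lerD//.
    by rewrite le_eqVlt; apply/orP; left; apply/eqP; field; rewrite gt_eqF.
  rewrite (_ : (2 - alpha)^-1 * (C * (2 - alpha) * V) = C * V); last first.
    by field; rewrite gt_eqF.
  by rewrite ler_wpM2l// ler_pdivrMr// ler_peMr//; lra.
by field; rewrite gt_eqF.
Qed.

(** Inside the unit ball the quadratic part contributes exactly the limit for
    every alpha, by the radial formula; the errors are at most a constant
    times e + (2 - alpha). *)
Lemma cvg_second_order (i0 : 'I_n) :
  (2 - alpha) * (\int[mu]_(y in D) SB alpha y) @[alpha --> (2 : R)^'-] -->
  - (laplacian u x * (second_moment p i0 * (n + 2)%:R) / 2).
Proof.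
set L := _ / 2.
have v0 : 0 <= vol * n%:R.
  rewrite mulr_ge0// fine_ge0// integral_ge0// => y _; rewrite lee_fin//.
apply/cvgrPdist_le => e e0.
pose eta := e / (2 * (vol * n%:R + 1)).
have eta0 : 0 < eta by rewrite divr_gt0// mulr_gt0// ltr_wpDl.
have [C C0 hC] := integral_ball_le i0 eta0.
have [K hK] := second_difference_quadratic.
pose T := 2 * M * (vol * expR n%:R / (1 - expR (- 1))).
pose B := C * (vol * n%:R) + `|T| + 1.
have CV := mulr_ge0 C0 v0.
have B0 : 0 < B by rewrite ltr_wpDl// addr_ge0.
near=> alpha.
have a2 : alpha < 2 by near: alpha; exact: nbhs_left_lt.
have a1 : 1 < alpha by near: alpha; apply: nbhs_left_gt; rewrite ltr1n.
have aB : 2 - e / (2 * B) < alpha.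
  by near: alpha; apply: nbhs_left_gt; rewrite gtrBl divr_gt0// mulr_gt0.
have h1 : 1 <= alpha < 2 by rewrite (ltW a1).
have ha : 0 < alpha < 2 by rewrite (lt_trans ltr01 a1).
have t0 : 0 <= 2 - alpha by rewrite subr_ge0 ltW.
have iSB := integrable_second_difference n_gt0 p1 mu_u mg g01 hK ha.
have -> : \int[mu]_(y in D) SB alpha y =
    (\int[mu]_(y in D1) SB alpha y) + (\int[mu]_(y in D2) SB alpha y).
  rewrite punctured_spaceE Rintegral_setU//; last exact: disjoint_ball_outer.
  by rewrite -punctured_spaceE.
have := hC _ h1; have := integral_outer_le h1; rewrite -/L -/T.
move: (\int[mu]_(y in D1) SB alpha y) (\int[mu]_(y in D2) SB alpha y) => I1 I2 h2 h3.
rewrite -normrN opprD !opprK (_ : L + _ = ((2 - alpha) * I1 + L) + (2 - alpha) * I2); last by ring.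
rewrite (le_trans (ler_normD _ _))// normrM (ger0_norm t0).
have h4 : (2 - alpha) * `|I2| <= (2 - alpha) * `|T|.
  by rewrite ler_wpM2l// (le_trans h2)// ler_norm.
rewrite (le_trans (lerD h3 h4))//.
have h5 : eta * (vol * n%:R) <= e / 2.
  rewrite /eta; move: v0; move: (vol * n%:R) => V V0.
  have V1 : 0 < V + 1 by rewrite ltr_wpDl.
  have -> : e / (2 * (V + 1)) * V = e / 2 * (V / (V + 1)) by field; rewrite gt_eqF.
  by rewrite ler_piMr ?divr_ge0 ?(ltW e0)// ler_pdivrMr// mul1r lerDl.
have h6 : (2 - alpha) * B <= e / 2.
  rewrite -ler_pdivlMr// -mulrA -invfM; lra.
move: h5 h6; rewrite /B mulrDl !mulrDr => h5 h6; lra.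
Unshelve. all: by end_near. Qed.

End second_order_limit.

(** * The area of the Euclidean sphere and the second moments *)

Section sphere.
Variables (R : realType) (n : nat).
Hypothesis n_gt0 : (0 < n)%N.
Local Notation mu := (lebesgue_row R n).

Let le12 : 1 <= 2 :> R. Proof. by rewrite ler1n. Qed.

Lemma cone_unit_sphere : cone (@unit_sphere R n) = @punctured_ball R n 2 1.
Proof.
apply/seteqP; split => y.
  move=> [r [t]]; rewrite /unit_sphere /= eucl_normE => t1 [/andP[r0 r1] ->].
  by rewrite /punctured_ball/= lp_normZ// t1 mulr1 gtr0_norm// r0.
rewrite /punctured_ball/= => /andP[N0 N1]; exists (lp_norm 2 y).
exists ((lp_norm 2 y)^-1 *: y).
  by rewrite /unit_sphere/= eucl_normE lp_normZ// gtr0_norm ?invr_gt0// mulVf ?gt_eqF.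
by rewrite N0 N1 scalerA mulfV ?gt_eqF// scale1r.
Qed.

Lemma sphere_areaE : sphere_area R n = n%:R * @ball_volume R n 2.
Proof.
rewrite /sphere_area /sphere_measure cone_unit_sphere fineM//; last first.
  rewrite ge0_fin_numE//; exact: lebesgue_punctured_ball_lty.
congr (_ * fine _); rewrite -[LHS]mul1e -integral_cst//.
exact: measurable_punctured_ball.
Qed.

(** The sum of the squared coordinates is the squared Euclidean norm. So the
    integral of N^(1-n) over the unit ball can be computed from the
    second moments or from the volume, and comparing the two gives the
    identity. *)
Lemma second_moment_eucl (i0 : 'I_n) :
  second_moment (2 : R) i0 * (n + 2)%:R = @ball_volume R n 2.
Proof.
have ha : 0 < (1 : R) < 2 by rewrite ltr01 ltr1n.
have mD1 : measurable (@punctured_ball R n 2 1) by exact: measurable_punctured_ball.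
pose h (i : 'I_n) (y : 'rV[R]_n) := y ord0 i * y ord0 i * (lp_norm 2 y `^ (n%:R + 1))^-1.
have hi i : mu.-integrable (@punctured_ball R n 2 1) (EFin \o h i).
  by have [] := Rintegral_coord_mul n_gt0 le12 i i ha.
have hE i : \int[mu]_(y in (@punctured_ball R n 2 1)) h i y = second_moment 2 i0 * (n + 2)%:R.
  have [_ ->] := Rintegral_coord_mul n_gt0 le12 i i ha.
  by rewrite eqxx (second_moment_const 2 i i0) (_ : 2 - 1 = 1) ?divr1//; ring.
have E : \int[mu]_(y in (@punctured_ball R n 2 1)) (\sum_i h i y) = @ball_volume R n 2 * n%:R.
  transitivity (\int[mu]_(y in (@punctured_ball R n 2 1)) (lp_norm 2 y `^ (2 - 1 - n%:R))).
    apply: eq_Rintegral => y; rewrite in_setE => /andP[N0 _].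
    rewrite /h -mulr_suml -(lp_powR_inv 1 2 N0) -eucl_normE sqr_sqrtr; last first.
      by apply: sumr_ge0 => i _; exact: sqr_ge0.
    by congr (_ / _); apply: eq_bigr => i _; rewrite expr2.
  rewrite Rintegral_ball_powR ?subr_gt0 ?ltr1n//.
  by rewrite (_ : 2 - 1 = 1) ?divr1//; ring.
move: E; rewrite (Rintegral_sum mD1 _ hi).
rewrite (eq_bigr (fun=> second_moment 2 i0 * (n + 2)%:R)) => [|i _]; last exact: hE.
rewrite sumr_const card_ord -[X in X = _ -> _]mulr_natr.
by move=> /mulIf -> //; rewrite pnatr_eq0 -lt0n.
Qed.

End sphere.

(** * Convergence to the Laplacian *)

(** Common form of the two parts of the theorem: k is the full normalizing
    factor of the kernel, and kappa measures it against 2 - alpha. *)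
Lemma cvg_pv_operator (R : realType) (n : nat) (p : R) (u g : 'rV[R]_n -> R)
    (x : 'rV[R]_n) (k : R -> R) (kappa : R) (i0 : 'I_n) :
  1 <= p -> C11_loc u -> u \in Lfun (lebesgue_row R n) +oo%E ->
  twice_differentiable u x ->
  measurable_fun setT g -> (forall y, 0 <= g y <= 1) -> (forall y, g (- y) = g y) ->
  (forall y, 1 - g y <= lp_norm p y ^+ 2) ->
  k alpha / (2 - alpha) @[alpha --> 2^'-] --> kappa ->
  (forall alpha, 0 < alpha < 2 -> pv_integrable
    (increment (fun y => k alpha * base_kernel p g alpha y) u x)) /\
  pv_integral (increment (fun y => k alpha * base_kernel p g alpha y) u x)
    @[alpha --> 2^'-] -->
  - (kappa * (second_moment p i0 * (n + 2)%:R / 2) * laplacian u x).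
Proof.
move=> p1 [du _] Lu u2 mg g01 gN g0 kk.
have n_gt0 : (0 < n)%N by case: (i0) => m; exact: leq_ltn_trans.
have cu : continuous u by move=> z; exact: differentiable_continuous.
have [M _ uM] := continuous_Lfun_bounded cu Lu.
have mu_u := measurable_Lfun Lu.
have [K hK] := second_difference_quadratic p1 uM u2.
have pv alpha : 0 < alpha < 2 ->
    pv_integrable (increment (fun y => k alpha * base_kernel p g alpha y) u x) /\
    pv_integral (increment (fun y => k alpha * base_kernel p g alpha y) u x) =
    k alpha * \int[lebesgue_row R n]_(y in [set y | 0 < lp_norm p y])
      (second_difference u x y * base_kernel p g alpha y).
  move=> ha.
  have [ipv <-] := pv_integral_second_difference n_gt0 p1 mu_u uM mg g01 gN hK ha.
  rewrite (_ : increment _ u x = fun y => k alpha * increment (base_kernel p g alpha) u x y).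
    exact: pv_integralZ.
  by apply/funext => y; rewrite /increment mulrCA.
split; first by move=> alpha ha; have [] := pv alpha ha.
have lim := cvgM kk (cvg_second_order n_gt0 p1 mu_u uM u2 mg g01 g0 (i0 := i0)).
rewrite (_ : - (_ * _) = kappa * - (laplacian u x * (second_moment p i0 * (n + 2)%:R) / 2)); last by ring.
move: (lim (at_left_proper_filter _)); apply: cvg_trans; apply: near_eq_cvg; near=> alpha.
have a2 : alpha < 2 by near: alpha; exact: nbhs_left_lt.
have a0 : 0 < alpha by near: alpha; exact: nbhs_left_gt.
have [|_ ->] := pv alpha; first by rewrite a0.
by rewrite /= mulrA divfK// subr_eq0 gt_eqF.
Unshelve. all: by end_near. Qed.

Theorem theorem1p3 (R : realType) (n : nat) (n_gt0 : (0 < n)%N) :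
  (forall u : 'rV[R]_n -> R,
    C11_loc u -> u \in Lfun (lebesgue_row R n) +oo%E ->
    forall x : 'rV[R]_n, twice_differentiable u x ->
      (forall alpha : R, 0 < alpha < 2 ->
        pv_integrable (increment (gauss_kernel alpha) u x)) /\
      gauss_operator alpha u x @[alpha --> 2^'-] --> - laplacian u x)
  /\
  (forall C : R, 0 < C ->
   forall p : R, 1 <= p ->
   exists2 Cnp : R, 0 < Cnp &
   forall u : 'rV[R]_n -> R,
     C11_loc u -> u \in Lfun (lebesgue_row R n) +oo%E ->
     forall x : 'rV[R]_n, twice_differentiable u x ->
       (forall alpha : R, 0 < alpha < 2 ->
         pv_integrable (increment (lp_kernel p alpha) u x)) /\
       lp_operator C p alpha u x @[alpha --> 2^'-] --> - (Cnp * laplacian u x)).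
Proof.
pose i0 : 'I_n := Ordinal n_gt0.
have kappa_cst (c : R) : c @[alpha --> (2 : R)^'-] --> c by exact: cvg_cst.
split=> [u uC uL x u2|C C0 p p1].
  have le12 : 1 <= 2 :> R by rewrite ler1n.
  pose g (y : 'rV[R]_n) := expR (- eucl_norm y ^+ 2).
  pose k (alpha : R) := (Gamma ((2 - alpha) / 2))^-1.
  have mg : measurable_fun setT g.
    apply: measurableT_comp; first exact: measurable_expR.
    apply: measurable_funN; apply: measurable_funX.
    exact: measurable_eucl_norm.
  have g01 y : 0 <= g y <= 1.
    by rewrite expR_ge0/= -expR0 ler_expR oppr_le0 sqr_ge0.
  have gN y : g (- y) = g y.
    by congr (expR (- _ ^+ 2)); rewrite !eucl_normE; exact: lp_normN.
  have g0 y : 1 - g y <= lp_norm 2 y ^+ 2.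
    rewrite -eucl_normE /g; have := expR_ge1Dx (- eucl_norm y ^+ 2); lra.
  have kk : k alpha / (2 - alpha) @[alpha --> (2 : R)^'-] --> (2^-1 : R).
    by under eq_cvg do rewrite /k -invfM mulrC; exact: cvg_Gamma_factor.
  have [ipv lim] := cvg_pv_operator i0 le12 uC uL u2 mg g01 gN g0 kk.
  have kE alpha : gauss_kernel alpha = fun y => k alpha * base_kernel 2 g alpha y.
    by apply/funext => y; rewrite /gauss_kernel /base_kernel /g eucl_normE.
  split=> [alpha ha|]; first by rewrite kE; exact: ipv.
  rewrite /gauss_operator; under eq_cvg do rewrite kE.
  have sm0 := second_moment_gt0 n_gt0 le12 i0.
  have n0 : (0 : R) < n%:R by rewrite ltr0n.
  rewrite (_ : - laplacian u x = 4 * n%:R / sphere_area R n *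
    - (2^-1 * (second_moment 2 i0 * (n + 2)%:R / 2) * laplacian u x)).
    exact: (cvgM (kappa_cst _) lim).
  rewrite sphere_areaE// -(second_moment_eucl R n_gt0 i0); field.
  by rewrite !gt_eqF//= ltr0n addn_gt0 orbT.
have sm0 := second_moment_gt0 n_gt0 p1 i0.
exists (C * (second_moment p i0 * (n + 2)%:R / 2)).
  by rewrite mulr_gt0// divr_gt0// mulr_gt0// ltr0n addn_gt0 orbT.
move=> u uC uL x u2.
pose g (y : 'rV[R]_n) : R := 1.
pose k (alpha : R) := 2 - alpha.
have mg : measurable_fun setT g by exact: measurable_cst.
have g01 y : 0 <= g y <= 1 by rewrite ler01 lexx.
have g0 y : 1 - g y <= lp_norm p y ^+ 2 by rewrite subrr sqr_ge0.
have kk : k alpha / (2 - alpha) @[alpha --> (2 : R)^'-] --> (1 : R).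
  apply: cvg_trans (kappa_cst 1); apply: near_eq_cvg; near=> alpha.
  by rewrite /k divff// subr_eq0 gt_eqF//; near: alpha; exact: nbhs_left_lt.
have [ipv lim] := cvg_pv_operator i0 p1 uC uL u2 mg g01 (fun=> erefl) g0 kk.
have kE alpha : lp_kernel p alpha = fun y => k alpha * base_kernel p g alpha y.
  by apply/funext => y; rewrite /lp_kernel /base_kernel /g mul1r.
split=> [alpha ha|]; first by rewrite kE; exact: ipv.
rewrite /lp_operator; under eq_cvg do rewrite kE.
rewrite (_ : - (_ * _) = C *
    - (1 * (second_moment p i0 * (n + 2)%:R / 2) * laplacian u x)); last by ring.
exact: (cvgM (kappa_cst _) lim).
Unshelve. all: by end_near. Qed.
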